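(* Let $B_{Reul}\subset\mathbb{R}^3$ be the constant width body obtained by rotating a Reuleaux triangle about one of its axes of symmetry. Then, amongst all constant width bodies of revolution in Euclidean space $\mathbb{R}^3$, the minimum of the ratio of the volume to the cubed width is attained by $B_{Reul}$. That is, for every constant width body of revolution $B\subset\mathbb{R}^3$, $$\frac{\mathrm{Vol}(B_{Reul})}{\mathrm{width}(B_{Reul})^3}\;\le\;\frac{\mathrm{Vol}(B)}{\mathrm{width}(B)^3}.$$
   Context: A convex body in $\mathbb{R}^n$ is a compact convex set with nonempty interior. The width of a convex body $B$ in the direction of a unit vector $\vec u$ is the distance between the two supporting hyperplanes of $B$ orthogonal to $\vec u$; $B$ has constant width if this number does not depend on $\vec u$, and the common value is then called the width of $B$. A body of revolution in $\mathbb{R}^3$ is a convex body invariant under all rotations around some line (its axis). A Reuleaux triangle is the intersection of three closed planar discs centered at the vertices of an equilateral triangle, each with radius equal to the side length of the triangle. To form $B_{Reul}$, place the Reuleaux triangle in a plane of $\mathbb{R}^3$ and rotate it in space about one of its axes of symmetry in that plane. *)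

(* Defs.v *)
From HB Require Import structures.
From mathcomp Require Import all_boot all_order all_algebra.
From mathcomp Require Import all_classical all_reals all_analysis.

Set Implicit Arguments.
Unset Strict Implicit.
Unset Printing Implicit Defensive.

Import Order.TTheory GRing.Theory Num.Theory.
Import numFieldNormedType.Exports.

Local Open Scope classical_set_scope.
Local Open Scope ring_scope.

(* The library's norm on 'rV[R]_n is the sup norm. It induces the usual
   topology, which is the one used by [compact] and [interior] below, but the
   metric notions need the Euclidean norm. *)
Definition dot (R : realType) (n : nat) (x y : 'rV[R]_n) : R :=
  \sum_i x 0 i * y 0 i.

Definition enorm (R : realType) (n : nat) (x : 'rV[R]_n) : R :=
  Num.sqrt (dot x x).

Definition edist (R : realType) (n : nat) (x y : 'rV[R]_n) : R :=
  enorm (x - y).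

Definition set_edist (R : realType) (n : nat) (A C : set 'rV[R]_n) : R :=
  inf [set edist x y | x in A & y in C].

Definition convex_body (R : realType) (n : nat) (B : set 'rV[R]_n) : Prop :=
  [/\ compact B, convex_set B & interior B !=set0].

Definition hyperplane (R : realType) (n : nat) (u : 'rV[R]_n) (h : R)
    : set 'rV[R]_n :=
  [set x | dot x u = h].

Definition upper_support (R : realType) (n : nat) (B : set 'rV[R]_n)
    (u : 'rV[R]_n) : set 'rV[R]_n :=
  hyperplane u (sup [set dot x u | x in B]).

Definition lower_support (R : realType) (n : nat) (B : set 'rV[R]_n)
    (u : 'rV[R]_n) : set 'rV[R]_n :=
  hyperplane u (inf [set dot x u | x in B]).

Definition width_in_direction (R : realType) (n : nat) (B : set 'rV[R]_n)
    (u : 'rV[R]_n) : R :=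
  set_edist (upper_support B u) (lower_support B u).

Definition has_width (R : realType) (n : nat) (B : set 'rV[R]_n) (w : R)
    : Prop :=
  forall u : 'rV[R]_n, enorm u = 1 -> width_in_direction B u = w.

Definition constant_width (R : realType) (n : nat) (B : set 'rV[R]_n) : Prop :=
  exists w : R, has_width B w.

(* For n >= 1 unit vectors exist, so the common value is unique. *)
Definition width (R : realType) (n : nat) (B : set 'rV[R]_n) : R :=
  xget 0 [set w | has_width B w].

Definition row3 (R : realType) (t : R * R * R) : 'rV[R]_3 :=
  \row_(i < 3) [:: t.1.1; t.1.2; t.2]`_i.

(* Three-dimensional Lebesgue measure, transported from R * R * R. *)
Definition volume (R : realType) (B : set 'rV[R]_3) : \bar R :=
  ((lebesgue_measure \x lebesgue_measure) \x lebesgue_measure)%E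
    (@row3 R @^-1` B).

(* Euclidean rotations around the line through p directed by u: the
   orientation-preserving isometries fixing that line pointwise. *)
Definition rotation_about (R : realType) (p u : 'rV[R]_3)
    : set ('rV[R]_3 -> 'rV[R]_3) :=
  [set f | exists A : 'M[R]_3,
    [/\ A *m A^T = 1%:M, \det A = 1, u *m A = u &
        forall x, f x = p + (x - p) *m A]].

Definition body_of_revolution (R : realType) (B : set 'rV[R]_3) : Prop :=
  convex_body B /\
  exists p u : 'rV[R]_3,
    enorm u = 1 /\ forall f, rotation_about p u f -> f @` B = B.

Definition constant_width_body_of_revolution (R : realType)
    (B : set 'rV[R]_3) : Prop :=
  body_of_revolution B /\ constant_width B.

Definition volume_width_ratio (R : realType) (B : set 'rV[R]_3) : \bar R :=
  (volume B * ((width B ^+ 3)^-1)%:E)%E.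

Definition equilateral (R : realType) (n : nat) (a b c : 'rV[R]_n) : Prop :=
  [/\ a != b, edist b c = edist a b & edist c a = edist a b].

Definition plane_through (R : realType) (n : nat) (a b c : 'rV[R]_n)
    : set 'rV[R]_n :=
  [set x | exists s t : R, x = a + s *: (b - a) + t *: (c - a)].

Definition eball (R : realType) (n : nat) (a : 'rV[R]_n) (r : R)
    : set 'rV[R]_n :=
  [set x | edist x a <= r].

Definition reuleaux (R : realType) (n : nat) (a b c : 'rV[R]_n)
    : set 'rV[R]_n :=
  plane_through a b c `&`
  (eball a (edist a b) `&` eball b (edist a b) `&` eball c (edist a b)).

Definition line (R : realType) (n : nat) (p u : 'rV[R]_n) : set 'rV[R]_n :=
  [set x | exists t : R, x = p + t *: u].

(* For a unit vector u, x is sent to its mirror image through its orthogonal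
   projection on the line; on any plane containing the line this is the planar
   reflection across the line. *)
Definition line_reflection (R : realType) (n : nat) (p u x : 'rV[R]_n)
    : 'rV[R]_n :=
  2 *: (p + dot (x - p) u *: u) - x.

Definition symmetry_axis_in (R : realType) (n : nat) (P T : set 'rV[R]_n)
    (p u : 'rV[R]_n) : Prop :=
  [/\ enorm u = 1, line p u `<=` P & line_reflection p u @` T = T].

Definition revolve (R : realType) (p u : 'rV[R]_3) (T : set 'rV[R]_3)
    : set 'rV[R]_3 :=
  \bigcup_(f in rotation_about p u) f @` T.

(* B is a copy of the rotated Reuleaux triangle, of arbitrary size and
   position, about any of the symmetry axes of the triangle. *)
Definition is_B_Reul (R : realType) (B : set 'rV[R]_3) : Prop :=
  exists a b c p u : 'rV[R]_3,
    [/\ equilateral a b c,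
        symmetry_axis_in (plane_through a b c) (reuleaux a b c) p u &
        B = revolve p u (reuleaux a b c)].

(* Main.v *)
From HB Require Import structures.
From mathcomp Require Import all_boot all_order all_algebra all_fingroup.
From mathcomp Require Import all_classical all_reals all_analysis.
From mathcomp Require Import measurable_realfun ring lra.
Require Import Defs.

(** In units of the width, let [K] be the meridian section of a body of constant
    width 1 with a vertical axis of revolution. For [0 <= t <= 1/2], the vertical
    chord of [K] at distance [t] from the axis has length at least
    [c t + c (t + 1/2) - c (1/2)], where [c s = sqrt (1 - s^2)]: this follows from
    the existence of a diameter of [K] in every direction, the symmetry and the
    convexity of [K], and the bound 1 on its diameter. For the Reuleaux triangle
    this is an equality. Hence every vertical section of the rotated Reuleaux
    triangle is at most as long as the corresponding section of any other such
    body, and Fubini's theorem compares the volumes. *)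

Set Implicit Arguments.
Unset Strict Implicit.
Unset Printing Implicit Defensive.

Import Order.TTheory GRing.Theory Num.Theory.
Import numFieldNormedType.Exports.

Local Open Scope classical_set_scope.
Local Open Scope ring_scope.

(** * Scaling of measures under maps *)

(** The numbers [t] and [t + 1/2] are read off the extremal triangle with vertices (-1/2, 0), (1/2,
    0) and (0, [circ 2^-1]). The lower end of its chord at abscissa [t] lies on the arc around the
    apex, the upper end on the arc around (-1/2, 0); diameters of horizontal extents [t] and
    [t + 1/2] join these ends to the two vertices, whose vertical gap [circ 2^-1] is the subtracted
    term. Two bodies have unrelated axes and widths, so each is carried by its own similarity to
    width 1 and to the third coordinate axis. Volume being a product measure in fixed coordinates,
    its behaviour under similarities is derived by factoring matrices into shears and scalings of
    one coordinate. The triangle and its axis are arbitrary too: it has to be proved that the axis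
    passes through a vertex, and since the triangle may point either way along it, [k] carries a
    sign. *)

Definition scales_measure d (T : measurableType d) (R : realType)
    (mu : set T -> \bar R) (c : R) (f : T -> T) : Prop :=
  measurable_fun setT f /\
  forall A, measurable A -> (mu (f @^-1` A) * c%:E)%E = mu A.

Lemma scales_measure_comp d (T : measurableType d) (R : realType)
    (mu : set T -> \bar R) (c c' : R) (f g : T -> T) :
  scales_measure mu c f -> scales_measure mu c' g ->
  scales_measure mu (c' * c) (g \o f).
Proof.
move=> [mf hf] [mg hg]; split; first exact: measurableT_comp.
move=> A mA; rewrite comp_preimage mulrC EFinM muleA hf ?hg//.
by rewrite -[X in measurable X]setTI; exact: mg.
Qed.

(** The section over [x] of the preimage of [A] is the preimage under [h x] of the section of [A],
    so [c] comes out of the integral that defines the product measure. *)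
Lemma scales_measure_fibre_r d1 d2 (T1 : measurableType d1)
    (T2 : measurableType d2) (R : realType)
    (m1 : {sigma_finite_measure set T1 -> \bar R})
    (m2 : {sigma_finite_measure set T2 -> \bar R})
    (c : R) (h : T1 -> T2 -> T2) : 0 <= c ->
  measurable_fun setT (fun q : T1 * T2 => h q.1 q.2) ->
  (forall x, scales_measure m2 c (h x)) ->
  scales_measure (m1 \x m2)%E c (fun q : T1 * T2 => (q.1, h q.1 q.2)).
Proof.
move=> c0 mh hh.
have mf : measurable_fun setT (fun q : T1 * T2 => (q.1, h q.1 q.2)).
  by apply/measurable_fun_pair.
split => // A mA.
have mfA : measurable ((fun q : T1 * T2 => (q.1, h q.1 q.2)) @^-1` A).
  by rewrite -[X in measurable X]setTI; exact: mf.
rewrite /product_measure1 -ge0_integralZr//; last exact: measurable_fun_xsection.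
apply: eq_integral => x _ /=; have [_ hx] := hh x.
rewrite -[RHS]hx; last exact: measurable_xsection.
by rewrite !xsectionE.
Qed.

Lemma scales_measure_fibre_l d1 d2 (T1 : measurableType d1)
    (T2 : measurableType d2) (R : realType)
    (m1 : {sigma_finite_measure set T1 -> \bar R})
    (m2 : {sigma_finite_measure set T2 -> \bar R})
    (c : R) (h : T2 -> T1 -> T1) : 0 <= c ->
  measurable_fun setT (fun q : T1 * T2 => h q.2 q.1) ->
  (forall y, scales_measure m1 c (h y)) ->
  scales_measure (m1 \x m2)%E c (fun q : T1 * T2 => (h q.2 q.1, q.2)).
Proof.
move=> c0 mh hh.
have mf : measurable_fun setT (fun q : T1 * T2 => (h q.2 q.1, q.2)).
  by apply/measurable_fun_pair.
split => // A mA.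
have mfA : measurable ((fun q : T1 * T2 => (h q.2 q.1, q.2)) @^-1` A).
  by rewrite -[X in measurable X]setTI; exact: mf.
(* The product measure integrates over the first factor; as the map moves that coordinate, the order
   of integration is exchanged by uniqueness of the product measure. *)
have E X : measurable X -> (m1 \x m2)%E X = (m1 \x^ m2)%E X.
  by apply: product_measure_unique => B C mB mC; exact: product_measure2E.
rewrite !E// /product_measure2 -ge0_integralZr//; last first.
  exact: measurable_fun_ysection.
apply: eq_integral => y _ /=; have [_ hy] := hh y.
rewrite -[RHS]hy; last exact: measurable_ysection.
by rewrite !ysectionE.
Qed.

(** Lebesgue measure is determined by its values on the intervals []a, b]], and [|s|] times the
    pushforward has the same values. For [s < 0] the preimage is half-open at the other end, with
    the same length. *)
Lemma lebesgue_measure_affine (R : realType) (s t : R) : s != 0 ->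
  scales_measure (@lebesgue_measure R) `|s| (fun x => s * x + t).
Proof.
move=> s0.
have mf : measurable_fun [set: measurableTypeR R]
    (fun x : measurableTypeR R => s * x + t : measurableTypeR R).
  apply: measurable_funD => //; exact: measurable_funM.
split => // A mA.
pose f := (fun x : measurableTypeR R => s * x + t : measurableTypeR R).
rewrite muleC; symmetry.
have := @lebesgue_measure_unique R (mscale (NngNum (normr_ge0 s)) (pushforward lebesgue_measure f)).
apply => // {A mA}.
move=> X /ocitvP [->|[[a b] /= ab ->]]; first by rewrite !measure0.
rewrite /mscale /= /pushforward.
rewrite lebesgue_measure_itv/= lte_fin ab.
have [sp|sn] : 0 < s \/ s < 0 by case: (ltgtP s 0) s0 => //; [right|left].
- rewrite [f @^-1` _](_ : _ = `](a - t) / s, (b - t) / s]%classic); last first.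
    apply/seteqP; split => x /=; rewrite !in_itv/= /f ltr_pdivrMr// ler_pdivlMr//;
      move=> /andP[h1 h2]; apply/andP; split; lra.
  rewrite lebesgue_measure_itv/= lte_fin ltr_pM2r ?invr_gt0// ltrD2r ab.
  rewrite -!EFinD -EFinM; congr EFin; rewrite gtr0_norm//; field; lra.
- rewrite [f @^-1` _](_ : _ = `[(b - t) / s, (a - t) / s[%classic); last first.
    apply/seteqP; split => x /=; rewrite !in_itv/= /f ltr_ndivlMr// ler_ndivrMr//;
      move=> /andP[h1 h2]; apply/andP; split; lra.
  rewrite lebesgue_measure_itv/= lte_fin ltr_nM2r ?invr_lt0// ltrD2r ab.
  rewrite -!EFinD -EFinM; congr EFin; rewrite ltr0_norm//; field; lra.
Qed.

(** * Linear maps and Lebesgue measure in space *)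

Section Coordinates.
Context {R : realType}.
Implicit Types (q : R * R * R) (x : 'rV[R]_3) (A B : 'M[R]_3).

Lemma big_ord3 (T : Type) (idx : T) (op : Monoid.law idx) (F : 'I_3 -> T) :
  \big[op/idx]_(i < 3) F i = op (op (F 0) (F 1)) (F 2).
Proof.
rewrite !big_ord_recl big_ord0 Monoid.mulm1 Monoid.mulmA.
by congr (op (op (F _) (F _)) (F _)); apply: val_inj.
Qed.

Lemma ord3P (P : 'I_3 -> Prop) : P 0 -> P 1 -> P 2 -> forall i, P i.
Proof.
by move=> P0 P1 P2 [[|[|[|//]]] h]; [move: P0|move: P1|move: P2];
  congr P; apply: val_inj.
Qed.

Lemma row3_0 q : row3 q 0 0 = q.1.1. Proof. by rewrite mxE. Qed.
Lemma row3_1 q : row3 q 0 1 = q.1.2. Proof. by rewrite mxE. Qed.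
Lemma row3_2 q : row3 q 0 2 = q.2. Proof. by rewrite mxE. Qed.
Definition row3E := (row3_0, row3_1, row3_2).

Definition triple x : R * R * R := (x 0 0, x 0 1, x 0 2).

Lemma tripleK : cancel triple (@row3 R).
Proof. by move=> x; apply/rowP; apply: ord3P; rewrite row3E. Qed.

Definition linmap A q : R * R * R := triple (row3 q *m A).

Lemma linmapE A q : linmap A q =
  (q.1.1 * A 0 0 + q.1.2 * A 1 0 + q.2 * A 2 0,
   q.1.1 * A 0 1 + q.1.2 * A 1 1 + q.2 * A 2 1,
   q.1.1 * A 0 2 + q.1.2 * A 1 2 + q.2 * A 2 2).
Proof. by rewrite /linmap /triple !mxE !big_ord3 !row3E. Qed.

(** Matrices act on row vectors from the right, hence the reversed order. *)
Lemma linmapM A B : linmap (A *m B) = linmap B \o linmap A.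
Proof. by apply/funext => q; rewrite /linmap /= tripleK mulmxA. Qed.

End Coordinates.

(* The library equips a product measure with its sigma-finite structure only
   when both factors are subprobabilities. *)
Definition lebesgue2 (R : realType) :
    set (measurableTypeR R * measurableTypeR R) -> \bar R :=
  (@lebesgue_measure R \x @lebesgue_measure R)%E.

HB.instance Definition _ (R : realType) := Measure.on (@lebesgue2 R).

(** The squares of an exhausting sequence exhaust the plane because the sequence is nondecreasing: a
    point with coordinates in [F n] and [F k] lies in the square of index [maxn n k]. *)
Lemma lebesgue2_sigma_finite (R : realType) : sigma_finite setT (@lebesgue2 R).
Proof.
have /sigma_finiteP[F [TF ndF Foo]] := sigma_finiteT (@lebesgue_measure R).
exists (fun n => F n `*` F n).
  rewrite -setXTT TF predeqE => -[x y]; split=> /=.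
    move=> [[n _ Fnx] [k _ Fky]]; exists (maxn n k) => //; split.
    - by move: x Fnx; exact/subsetPset/ndF/leq_maxl.
    - by move: y Fky; exact/subsetPset/ndF/leq_maxr.
  by move=> [n _ [? ?]]; split; exists n.
move=> k; have [mF Fk] := Foo k; split; first exact: measurableX.
by rewrite /lebesgue2 product_measure1E// lte_mul_pinfty// ge0_fin_numE.
Qed.

HB.instance Definition _ (R : realType) := Measure_isSigmaFinite.Build
  _ _ _ (@lebesgue2 R) (@lebesgue2_sigma_finite R).

Definition lebesgue3 (R : realType) :
    set (measurableTypeR R * measurableTypeR R * measurableTypeR R) -> \bar R :=
  (@lebesgue2 R \x @lebesgue_measure R)%E.

Section LinearMaps.
Context {R : realType}.
Let T2 := (measurableTypeR R * measurableTypeR R)%type.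
Let T3 := (measurableTypeR R * measurableTypeR R * measurableTypeR R)%type.
Implicit Types A B : 'M[R]_3.

(** With the other two coordinates frozen, the map is affine in the remaining one; two fibrewise
    extensions reach dimension 3. The next two lemmas treat the other coordinates. *)
Lemma scales_measure_x (s : R) (g : T2 -> R) : s != 0 -> measurable_fun setT g ->
  scales_measure (@lebesgue3 R) `|s|
    (fun q : T3 => (s * q.1.1 + g (q.1.2, q.2), q.1.2, q.2)).
Proof.
move=> s0 mg.
apply: (@scales_measure_fibre_l _ _ T2 (measurableTypeR R) R
  (@lebesgue2 R) lebesgue_measure _
  (fun z q => (s * q.1 + g (q.2, z), q.2))) => //.
- apply/measurable_fun_pair => /=; last exact: measurableT_comp.
  apply: measurable_funD; last apply: (measurableT_comp mg).
    by apply: measurable_funM => //; do 2 apply: measurableT_comp => //.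
  by apply/measurable_fun_pair => //; exact: measurableT_comp.
- move=> z; apply: (@scales_measure_fibre_l _ _ (measurableTypeR R) (measurableTypeR R) R
    lebesgue_measure lebesgue_measure _ (fun y x => s * x + g (y, z))) => //.
  + apply: measurable_funD; first exact: measurable_funM.
    by apply: (measurableT_comp mg); exact/measurable_fun_pair.
  + by move=> y; exact: lebesgue_measure_affine.
Qed.

Lemma scales_measure_y (s : R) (g : T2 -> R) : s != 0 -> measurable_fun setT g ->
  scales_measure (@lebesgue3 R) `|s|
    (fun q : T3 => (q.1.1, s * q.1.2 + g (q.1.1, q.2), q.2)).
Proof.
move=> s0 mg.
apply: (@scales_measure_fibre_l _ _ T2 (measurableTypeR R) R
  (@lebesgue2 R) lebesgue_measure _
  (fun z q => (q.1, s * q.2 + g (q.1, z)))) => //.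
- apply/measurable_fun_pair => /=; first exact: measurableT_comp.
  apply: measurable_funD; last apply: (measurableT_comp mg).
    by apply: measurable_funM => //; do 2 apply: measurableT_comp => //.
  by apply/measurable_fun_pair => //; exact: measurableT_comp.
- move=> z; apply: (@scales_measure_fibre_r _ _ (measurableTypeR R) (measurableTypeR R) R
    lebesgue_measure lebesgue_measure _ (fun x y => s * y + g (x, z))) => //.
  + apply: measurable_funD; first exact: measurable_funM.
    by apply: (measurableT_comp mg); exact/measurable_fun_pair.
  + by move=> y; exact: lebesgue_measure_affine.
Qed.

Lemma scales_measure_z (s : R) (g : T2 -> R) : s != 0 -> measurable_fun setT g ->
  scales_measure (@lebesgue3 R) `|s| (fun q : T3 => (q.1, s * q.2 + g q.1)).
Proof.
move=> s0 mg; apply: (@scales_measure_fibre_r _ _ T2 (measurableTypeR R) R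
  (@lebesgue2 R) lebesgue_measure _
  (fun p z => s * z + g p)) => //.
- apply: measurable_funD; first exact: measurable_funM.
  exact: measurableT_comp.
- by move=> p; exact: lebesgue_measure_affine.
Qed.

Let measurable_lin2 (a b : R) :
  measurable_fun [set: T2] (fun p : T2 => a * p.1 + b * p.2).
Proof. by apply: measurable_funD; exact: measurable_funM. Qed.

Definition scales_volume A := scales_measure (@lebesgue3 R) `|\det A| (linmap A).

Lemma scales_volumeM A B :
  scales_volume A -> scales_volume B -> scales_volume (A *m B).
Proof.
move=> hA hB; rewrite /scales_volume det_mulmx normrM linmapM mulrC.
exact: scales_measure_comp.
Qed.

Let det_lower A : A 0 1 = 0 -> A 0 2 = 0 -> A 1 2 = 0 ->
  \det A = A 0 0 * A 1 1 * A 2 2.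
Proof.
move=> h01 h02 h12; rewrite det_trig ?big_ord3//.
by apply/is_trig_mxP; apply: ord3P; apply: ord3P.
Qed.

(** The new third coordinate uses the old first two, and the new second uses the old first. The
    coordinates can therefore be updated in place in the order z, y, x, one shear each. *)
Lemma scales_volume_upper A : A 1 0 = 0 -> A 2 0 = 0 -> A 2 1 = 0 ->
  \det A != 0 -> scales_volume A.
Proof.
move=> h10 h20 h21; rewrite /scales_volume -det_tr det_lower ?mxE//.
rewrite !mulf_eq0 !negb_or !normrM => /andP[/andP[a0 a1] a2].
have -> : linmap A =
  (fun q : T3 => (A 0 0 * q.1.1 + (0 * q.1.2 + 0 * q.2), q.1.2, q.2)) \o
  (fun q : T3 => (q.1.1, A 1 1 * q.1.2 + (A 0 1 * q.1.1 + 0 * q.2), q.2)) \o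
  (fun q : T3 => (q.1, A 2 2 * q.2 + (A 0 2 * q.1.1 + A 1 2 * q.1.2))).
  by apply/funext => -[[x y] z]; rewrite linmapE /= h10 h20 h21;
    congr (_, _, _); ring.
apply: scales_measure_comp; last apply: scales_measure_comp.
- exact: (scales_measure_z a2 (measurable_lin2 _ _)).
- exact: (scales_measure_y a1 (measurable_lin2 _ _)).
- exact: (scales_measure_x a0 (measurable_lin2 _ _)).
Qed.

(** Update in place again, now in the order x, y, z. *)
Lemma scales_volume_lower A : A 0 1 = 0 -> A 0 2 = 0 -> A 1 2 = 0 ->
  \det A != 0 -> scales_volume A.
Proof.
move=> h01 h02 h12; rewrite /scales_volume det_lower//.
rewrite !mulf_eq0 !negb_or !normrM => /andP[/andP[a0 a1] a2].
have -> : linmap A =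
  (fun q : T3 => (q.1, A 2 2 * q.2 + (0 * q.1.1 + 0 * q.1.2))) \o
  ((fun q : T3 => (q.1.1, A 1 1 * q.1.2 + (0 * q.1.1 + A 2 1 * q.2), q.2)) \o
  (fun q : T3 => (A 0 0 * q.1.1 + (A 1 0 * q.1.2 + A 2 0 * q.2), q.1.2, q.2))).
  by apply/funext => -[[x y] z]; rewrite linmapE /= h01 h02 h12;
    congr (_, _, _); ring.
rewrite mulrC.
apply: scales_measure_comp; first rewrite mulrC; first apply: scales_measure_comp.
- exact: (scales_measure_x a0 (measurable_lin2 _ _)).
- exact: (scales_measure_y a1 (measurable_lin2 _ _)).
- exact: (scales_measure_z a2 (measurable_lin2 _ _)).
Qed.

Let scales_measure_1 (f : T3 -> T3) c : c = 1 ->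
  scales_measure (@lebesgue3 R) c f -> scales_measure (@lebesgue3 R) 1 f.
Proof. by move=> ->. Qed.

(** A swap is three shears, (x, y) to (x + y, y) to (x + y, x) to (y, x), with factors 1, -1, 1. *)
Lemma scales_volume_tperm (i j : 'I_3) : i != j -> scales_volume (tperm_mx i j).
Proof.
rewrite /scales_volume det_perm normrX normrN1 expr1n => ij.
have -> : linmap (tperm_mx i j) = (fun q : T3 => triple (xcol i j (row3 q))).
  by apply/funext => q; rewrite xcolE.
wlog: i j ij / (i < j)%N => [th|].
  have [|ji] := ltnP i j; first exact: th.
  have -> : (fun q : T3 => triple (xcol i j (row3 q))) =
    (fun q => triple (xcol j i (row3 q))).
    by apply/funext => q; rewrite /xcol tpermC.
  by apply: th; rewrite ?ltn_neqAle ?ji ?andbT// eq_sym.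
move: i j ij; apply: ord3P; apply: ord3P => // _ _.
- have -> : (fun q : T3 => triple (xcol 0 1 (row3 q))) =
    (fun q : T3 => (1 * q.1.1 + (-1 * q.1.2 + 0 * q.2), q.1.2, q.2)) \o
    (fun q : T3 => (q.1.1, -1 * q.1.2 + (1 * q.1.1 + 0 * q.2), q.2)) \o
    (fun q : T3 => (1 * q.1.1 + (1 * q.1.2 + 0 * q.2), q.1.2, q.2)).
    apply/funext => -[[x y] z]; rewrite /triple /= !mxE tpermL tpermR tpermD//=.
    by congr (_, _, _); ring.
  apply: (@scales_measure_1 _ (`|1| * `|-1| * `|1|)).
    by rewrite normrN1 normr1 !mulr1.
  apply: scales_measure_comp; last apply: scales_measure_comp.
  + by apply: (scales_measure_x _ (measurable_lin2 1 0)); rewrite ?oppr_eq0 oner_eq0.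
  + by apply: (scales_measure_y _ (measurable_lin2 1 0)); rewrite ?oppr_eq0 oner_eq0.
  + by apply: (scales_measure_x _ (measurable_lin2 (-1) 0)); rewrite ?oppr_eq0 oner_eq0.
- have -> : (fun q : T3 => triple (xcol 0 2 (row3 q))) =
    (fun q : T3 => (1 * q.1.1 + (0 * q.1.2 + -1 * q.2), q.1.2, q.2)) \o
    (fun q : T3 => (q.1, -1 * q.2 + (1 * q.1.1 + 0 * q.1.2))) \o
    (fun q : T3 => (1 * q.1.1 + (0 * q.1.2 + 1 * q.2), q.1.2, q.2)).
    apply/funext => -[[x y] z]; rewrite /triple /= !mxE tpermL tpermR tpermD//=.
    by congr (_, _, _); ring.
  apply: (@scales_measure_1 _ (`|1| * `|-1| * `|1|)).
    by rewrite normrN1 normr1 !mulr1.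
  apply: scales_measure_comp; last apply: scales_measure_comp.
  + by apply: (scales_measure_x _ (measurable_lin2 0 1)); rewrite ?oppr_eq0 oner_eq0.
  + by apply: (scales_measure_z _ (measurable_lin2 1 0)); rewrite ?oppr_eq0 oner_eq0.
  + by apply: (scales_measure_x _ (measurable_lin2 0 (-1))); rewrite ?oppr_eq0 oner_eq0.
- have -> : (fun q : T3 => triple (xcol 1 2 (row3 q))) =
    (fun q : T3 => (q.1.1, 1 * q.1.2 + (0 * q.1.1 + -1 * q.2), q.2)) \o
    (fun q : T3 => (q.1, -1 * q.2 + (0 * q.1.1 + 1 * q.1.2))) \o
    (fun q : T3 => (q.1.1, 1 * q.1.2 + (0 * q.1.1 + 1 * q.2), q.2)).
    apply/funext => -[[x y] z]; rewrite /triple /= !mxE tpermL tpermR tpermD//=.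
    by congr (_, _, _); ring.
  apply: (@scales_measure_1 _ (`|1| * `|-1| * `|1|)).
    by rewrite normrN1 normr1 !mulr1.
  apply: scales_measure_comp; last apply: scales_measure_comp.
  + by apply: (scales_measure_y _ (measurable_lin2 0 1)); rewrite ?oppr_eq0 oner_eq0.
  + by apply: (scales_measure_z _ (measurable_lin2 0 1)); rewrite ?oppr_eq0 oner_eq0.
  + by apply: (scales_measure_y _ (measurable_lin2 0 (-1))); rewrite ?oppr_eq0 oner_eq0.
Qed.

Lemma scales_volume_perm (s : 'S_3) : scales_volume (perm_mx s).
Proof.
have [ts -> ne_ts] := prod_tpermP s.
elim: ts ne_ts => [_|t ts IH /= /andP[t12 /IH h]].
  rewrite big_nil perm_mx1; apply: scales_volume_upper; rewrite ?mxE//.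
  by rewrite det1 oner_eq0.
rewrite big_cons perm_mxM; apply: scales_volumeM => //.
exact: scales_volume_tperm.
Qed.

(** The LUP factorization leaves a permutation, a lower triangular factor of determinant 1, and an
    upper triangular factor that is invertible because [A] is. *)
Lemma scales_volume_unitmx A : A \in unitmx -> scales_volume A.
Proof.
move=> uA; move: (cormen_lup_correct A) (cormen_lup_perm A) (cormen_lup_detL A)
  (@cormen_lup_lower _ _ A) (@cormen_lup_upper _ _ A).
case: cormen_lup => [[P L] U] PA /is_perm_mxP[s Ps] dL hL hU.
rewrite [P]Ps in PA.
have AE : A = perm_mx s^-1 *m L *m U.
  by rewrite -mulmxA -[_ *m U]PA mulmxE mulrA -mulmxE -perm_mxM mulVg perm_mx1 mul1mx.
have dU : \det U != 0.
  move: uA; rewrite AE unitmxE !det_mulmx unitfE dL mulr1 mulf_eq0 negb_or.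
  by case/andP.
rewrite AE; apply: scales_volumeM; last first.
  exact: scales_volume_upper (hU _ _ _) (hU _ _ _) (hU _ _ _) dU.
apply: scales_volumeM; first exact: scales_volume_perm.
apply: scales_volume_lower; rewrite ?hL//.
by rewrite dL oner_eq0.
Qed.

Lemma scales_volume_translation (p : R * R * R) :
  scales_measure (@lebesgue3 R) 1
    (fun q : T3 => (q.1.1 + p.1.1, q.1.2 + p.1.2, q.2 + p.2)).
Proof.
have -> : (fun q : T3 => (q.1.1 + p.1.1, q.1.2 + p.1.2, q.2 + p.2)) =
    (fun q : T3 => (1 * q.1.1 + p.1.1, q.1.2, q.2)) \o
    (fun q : T3 => (q.1.1, 1 * q.1.2 + p.1.2, q.2)) \o
    (fun q : T3 => (q.1, 1 * q.2 + p.2)).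
  by apply/funext => -[[x y] z]; rewrite /= !mul1r.
apply: (@scales_measure_1 _ (`|1| * `|1| * `|1|)).
  by rewrite normr1 !mulr1.
apply: scales_measure_comp; last apply: scales_measure_comp.
- by apply: (scales_measure_z _ (measurable_cst p.2)); rewrite oner_eq0.
- by apply: (scales_measure_y _ (measurable_cst p.1.2)); rewrite oner_eq0.
- by apply: (scales_measure_x _ (measurable_cst p.1.1)); rewrite oner_eq0.
Qed.

Lemma volume_affine_preimage A (p : 'rV[R]_3) (B : set 'rV[R]_3) :
  A \in unitmx -> measurable ((@row3 R @^-1` B) : set T3) ->
  (volume ((fun x => p + x *m A)%R @^-1` B) * `|\det A|%:E = volume B)%E.
Proof.
move=> uA mB.
have [_ /(_ _ mB) h] := scales_measure_comp (scales_volume_unitmx uA)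
  (scales_volume_translation (triple p)).
rewrite [RHS](_ : _ = lebesgue3 (@row3 R @^-1` B))// -[RHS]h mul1r.
rewrite [volume _](_ : _ = lebesgue3 (@row3 R @^-1`
  ((fun x => p + x *m A)%R @^-1` B)))//; congr (lebesgue3 _ * _)%E.
have E q : p + row3 q *m A = row3 ((linmap A q).1.1 + (triple p).1.1,
    (linmap A q).1.2 + (triple p).1.2, (linmap A q).2 + (triple p).2).
  by apply/rowP; apply: ord3P; rewrite row3E /= mxE addrC.
by apply/seteqP; split => q; rewrite /preimage /= E.
Qed.

(** Measurability refers to the product sigma-algebra, so [U] is written as a countable union of
    cubes with rational centre and size. A cube of half-side [d < e / 2] that contains the point
    lies in its sup-norm ball of radius [e]. *)
Lemma open_measurable_row3 (U : set 'rV[R]_3) :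
  open U -> measurable ((@row3 R @^-1` U) : set T3).
Proof.
move=> oU.
pose box (t : rat * rat * rat * rat) : set T3 :=
  (ball (ratr t.1.1.1 : R) (ratr t.2) `*` ball (ratr t.1.1.2 : R) (ratr t.2))
  `*` ball (ratr t.1.2 : R) (ratr t.2).
pose F t : set T3 := if `[< box t `<=` @row3 R @^-1` U >] then box t else set0.
rewrite [X in measurable X](_ : _ = \bigcup_t F t).
  apply: countable_bigcupT_measurable => // t.
  rewrite /F; case: ifP => _ //.
  by apply: measurableX; [apply: measurableX|]; exact: measurable_ball.
apply/seteqP; split => [q /= Uq|q [t _]]; last first.
  by rewrite /F; case: asboolP => [h /h|_ []].
have /nbhs_ballP[e e0 he] : nbhs (row3 q) U by exact: open_nbhs_nbhs.
have /rat_in_itvoo[d] : 0 < e / 2 by rewrite divr_gt0.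
rewrite in_itv/= => /andP[d0 de].
have approx x : exists r, `|ratr r - x| < ratr d :> R.
  have /rat_in_itvoo[r] : x - ratr d < x + ratr d by lra.
  by rewrite in_itv/= => /andP[h1 h2]; exists r; rewrite ltr_norml; apply/andP; split; lra.
have [a ha] := approx q.1.1; have [b hb] := approx q.1.2; have [c hc] := approx q.2.
exists (a, b, c, d) => //; rewrite /F; case: asboolP => [_|]; first by split; [split|].
case=> q' [[/= ha' hb'] hc']; apply: he; split => // i; rewrite (ord1 i).
have tri (x y r : R) : `|r - x| < ratr d -> `|r - y| < ratr d -> `|x - y| < e.
  by rewrite !ltr_norml => /andP[? ?] /andP[? ?]; apply/andP; split; lra.
apply: ord3P; rewrite !row3E.
- exact: tri ha ha'.
- exact: tri hb hb'.
- exact: tri hc hc'.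
Qed.

Lemma closed_measurable_row3 (B : set 'rV[R]_3) :
  closed B -> measurable ((@row3 R @^-1` B) : set T3).
Proof.
move=> /closed_openC/open_measurable_row3/measurableC.
by rewrite -preimage_setC setCK.
Qed.

End LinearMaps.

(** * Width *)

Section Dot.
Context {R : realType} {n : nat}.
Implicit Types (x y z u v : 'rV[R]_n) (a h w : R) (A : 'M[R]_n) (B : set 'rV[R]_n).

Lemma dotC x y : dot x y = dot y x.
Proof. by apply: eq_bigr => i _; rewrite mulrC. Qed.

Lemma dotDl x y z : dot (x + y) z = dot x z + dot y z.
Proof. by rewrite -big_split; apply: eq_bigr => i _; rewrite mxE mulrDl. Qed.

Lemma dotZl a x y : dot (a *: x) y = a * dot x y.
Proof. by rewrite /dot mulr_sumr; apply: eq_bigr => i _; rewrite mxE mulrA. Qed.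

Lemma dotDr x y z : dot z (x + y) = dot z x + dot z y.
Proof. by rewrite dotC dotDl !(dotC z). Qed.

Lemma dotZr a x y : dot y (a *: x) = a * dot y x.
Proof. by rewrite dotC dotZl (dotC y). Qed.

Lemma dotNl x y : dot (- x) y = - dot x y.
Proof. by rewrite -scaleN1r dotZl mulN1r. Qed.

Lemma dotNr x y : dot y (- x) = - dot y x.
Proof. by rewrite dotC dotNl (dotC y). Qed.

Definition dotE := (dotDl, dotDr, dotZl, dotZr, dotNl, dotNr).

Lemma dot_ge0 x : 0 <= dot x x.
Proof. by apply: sumr_ge0 => i _; rewrite -expr2 sqr_ge0. Qed.

Lemma dot_eq0 x : (dot x x == 0) = (x == 0).
Proof.
apply/eqP/eqP => [|->]; last by rewrite -[0 in LHS](scale0r 0) dotZl mul0r.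
move/psumr_eq0P => h; apply/rowP => i; rewrite mxE.
by apply/eqP; rewrite -[_ == 0]orbb -mulf_eq0 h// => j _; rewrite -expr2 sqr_ge0.
Qed.

Lemma dot_trmx x y : dot x y = (x *m y^T) 0 0.
Proof. by rewrite mxE; apply: eq_bigr => i _; rewrite mxE. Qed.

Lemma dot_mulmx A x y : A *m A^T = 1%:M -> dot (x *m A) (y *m A) = dot x y.
Proof.
by move=> AA; rewrite !dot_trmx trmx_mul mulmxA -(mulmxA x) AA mulmx1.
Qed.

Lemma enorm_eq1 x : enorm x = 1 <-> dot x x = 1.
Proof.
split=> [h|h]; last by rewrite /enorm h sqrtr1.
by rewrite -(sqr_sqrtr (dot_ge0 x)) -/(enorm x) h expr1n.
Qed.

Lemma sqr_enorm x : enorm x ^+ 2 = dot x x.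
Proof. by rewrite sqr_sqrtr ?dot_ge0. Qed.

Lemma edist_sqr x y : edist x y ^+ 2 = dot (x - y) (x - y).
Proof. exact: sqr_enorm. Qed.

Lemma edist_ge0 x y : 0 <= edist x y.
Proof. exact: sqrtr_ge0. Qed.

Lemma ler_edist x y a : 0 <= a -> (edist x y <= a) = (dot (x - y) (x - y) <= a ^+ 2).
Proof. by move=> a0; rewrite -edist_sqr ler_sqr// ?nnegrE ?edist_ge0. Qed.

Lemma dot_unit_le x u : dot u u = 1 -> `|dot x u| <= enorm x.
Proof.
move=> u1; rewrite -sqrtr_sqr ler_wsqrtr//.
have := dot_ge0 (x - dot x u *: u); rewrite !dotE (dotC u x) u1.
by move=> ?; lra.
Qed.

Lemma continuous_dot u : continuous (fun x => dot x u).
Proof.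
apply: continuous_big => [|i _ x]; first exact: add_continuous.
by apply: continuousM; [exact: coord_continuous|exact: cst_continuous].
Qed.

Lemma set_edist_hyperplane u h h' : dot u u = 1 -> h' <= h ->
  set_edist (hyperplane u h) (hyperplane u h') = h - h'.
Proof.
move=> u1 hh; rewrite /set_edist.
set D := [set edist x y | x in hyperplane u h & y in hyperplane u h'].
have lbD : lbound D (h - h').
  move=> _ [x xh [y yh <-]].
  by rewrite -xh -yh -dotNl -dotDl; apply: le_trans (dot_unit_le _ u1); exact: ler_norm.
have Dh : D (h - h').
  exists (h *: u); first by rewrite /hyperplane /= dotZl u1 mulr1.
  exists (h' *: u); first by rewrite /hyperplane /= dotZl u1 mulr1.
  by rewrite /edist -scalerBl /enorm dotZl dotZr u1 mulr1 -expr2 sqrtr_sqr ger0_norm ?subr_ge0.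
apply/eqP; rewrite eq_le; apply/andP; split.
- by apply: ge_inf => //; exists (h - h').
- by apply: lb_le_inf => //; exists (h - h').
Qed.

Definition shadow B u : set R := [set dot x u | x in B].

Lemma width_in_directionE B u : dot u u = 1 -> has_sup (shadow B u) ->
  has_inf (shadow B u) ->
  width_in_direction B u = sup (shadow B u) - inf (shadow B u).
Proof.
move=> u1 hs hi; rewrite /width_in_direction set_edist_hyperplane//.
by case: (hs) => -[a Sa] _; apply: (@le_trans _ _ a);
  [exact: ge_inf hi.2 _ Sa|exact: ub_le_sup hs.2 _ Sa].
Qed.

(** Constant width without supporting hyperplanes. For compact nonempty sets and [0 <= w] it is
    equivalent to [has_width], and it passes easily to similar copies and to meridian sections. *)
Definition diametral B w : Prop :=
  (forall x y, B x -> B y -> dot (x - y) (x - y) <= w ^+ 2) /\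
  (forall v, dot v v = 1 -> exists x y, [/\ B x, B y & x - y = w *: v]).

(** The ends of the chord along [u] lie on the two supporting hyperplanes: a point beyond either of
    them would be farther than [w] from the opposite end. *)
Lemma diametral_has_width B w : 0 <= w -> diametral B w -> has_width B w.
Proof.
move=> w0 [dB sB] u /enorm_eq1 u1; have [x [y [Bx By xy]]] := sB u u1.
have lew p q : B p -> B q -> dot p u - dot q u <= w.
  move=> Bp Bq; rewrite -dotNl -dotDl; apply: le_trans (ler_norm _) _.
  by apply: le_trans (dot_unit_le _ u1) _; rewrite -/(edist p q) ler_edist//; exact: dB.
have Sx : shadow B u (dot x u) by exists x.
have Sy : shadow B u (dot y u) by exists y.
have E : dot x u = dot y u + w.
  by rewrite -[x](subrK y) xy addrC dotDl dotZl u1 mulr1.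
have ubS : ubound (shadow B u) (dot x u).
  by move=> _ [a Ba <-]; have := lew _ _ Ba By; rewrite E; lra.
have lbS : lbound (shadow B u) (dot y u).
  by move=> _ [a Ba <-]; have := lew _ _ Bx Ba; rewrite E; lra.
have hs : has_sup (shadow B u) by split; exists (dot x u).
have hi : has_inf (shadow B u) by split; [exists (dot x u)|exists (dot y u)].
rewrite width_in_directionE//.
have -> : sup (shadow B u) = dot x u.
  apply/eqP; rewrite eq_le; apply/andP; split; first by apply: ge_sup => //; exists (dot x u).
  by apply: ub_le_sup => //; exists (dot x u).
have -> : inf (shadow B u) = dot y u.
  apply/eqP; rewrite eq_le; apply/andP; split; last by apply: lb_le_inf => //; exists (dot y u).
  by apply: ge_inf => //; exists (dot y u).
by rewrite E addrC addKr.
Qed.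

Lemma compact_shadow B u : compact B -> B !=set0 ->
  exists x y, [/\ B x, B y, has_sup (shadow B u), has_inf (shadow B u) &
    dot x u = sup (shadow B u) /\ dot y u = inf (shadow B u)].
Proof.
move=> cB B0.
have cu : {within B, continuous (fun x => dot x u)}.
  by apply: continuous_subspaceT; exact: continuous_dot.
have [x /set_mem Bx xmax] := EVT_max_rV B0 cB cu.
have [y /set_mem By ymin] := EVT_min_rV B0 cB cu.
have ubS : ubound (shadow B u) (dot x u).
  by move=> _ [a Ba <-]; apply: xmax; exact: mem_set.
have lbS : lbound (shadow B u) (dot y u).
  by move=> _ [a Ba <-]; apply: ymin; exact: mem_set.
have hs : has_sup (shadow B u) by split; exists (dot x u) => //; exists x.
have hi : has_inf (shadow B u).
  by split; [exists (dot x u); exists x|exists (dot y u)].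
exists x, y; split => //; split; apply/eqP; rewrite eq_le; apply/andP; split.
- by apply: ub_le_sup hs.2 _ _; exists x.
- by apply: ge_sup hs.1 _.
- by apply: lb_le_inf hi.1 _.
- by apply: ge_inf hi.2 _ _; exists y.
Qed.

(** The distance of two points is the length of their projection on their own direction, hence at
    most the width. Conversely, contact points of the two supporting hyperplanes differ by a vector
    [d] with [dot d v = w] and norm at most [w], so the squared norm of [d - w *: v] is at most
    0. *)
Lemma has_width_diametral B w : compact B -> B !=set0 -> 0 <= w ->
  has_width B w -> diametral B w.
Proof.
move=> cB B0 w0 hw.
have wE u : dot u u = 1 -> sup (shadow B u) - inf (shadow B u) = w.
  move=> u1; have [x [y [_ _ hs hi _]]] := compact_shadow u cB B0.
  by rewrite -width_in_directionE//; apply: hw; exact/enorm_eq1.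
have dB x y : B x -> B y -> dot (x - y) (x - y) <= w ^+ 2.
  move=> Bx By; rewrite -ler_edist//; have [->//|d0] := eqVneq (edist x y) 0.
  pose u := (edist x y)^-1 *: (x - y).
  have u1 : dot u u = 1.
    by rewrite dotZl dotZr -edist_sqr mulrA -expr2 exprVn mulVf// expf_neq0.
  have [_ [_ [_ _ hs hi _]]] := compact_shadow u cB B0.
  have : dot x u <= sup (shadow B u) by apply: ub_le_sup hs.2 _ _; exists x.
  have : inf (shadow B u) <= dot y u by apply: ge_inf hi.2 _ _; exists y.
  have : dot (x - y) u = edist x y.
    by rewrite dotZr -edist_sqr expr2 mulrA mulVf// mul1r.
  by rewrite dotDl dotNl -(wE u u1); lra.
split=> // v v1; have [x [y [Bx By _ _ [xE yE]]]] := compact_shadow v cB B0.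
exists x, y; split => //; apply/eqP; rewrite -subr_eq0 -dot_eq0.
rewrite eq_le dot_ge0 andbT.
have := dB _ _ Bx By; have : dot (x - y) v = w by rewrite dotDl dotNl xE yE wE.
move: (x - y : 'rV[R]_n) => d dv; rewrite !dotE [dot v d]dotC dv v1; lra.
Qed.

Lemma width_in_direction_gt0 B u : convex_body B -> dot u u = 1 ->
  0 < width_in_direction B u.
Proof.
move=> [cB _ [x Bx]] u1; have B0 : B !=set0 by exists x; exact: interior_subset.
have [_ [_ [_ _ hs hi _]]] := compact_shadow u cB B0.
rewrite width_in_directionE//.
have cf : (fun t : R => x + t *: u) @ (0 : R) --> x.
  rewrite -[x in X in _ --> X]addr0 -[X in x + X](scale0r u).
  by apply: cvgD; [exact: cvg_cst|apply: cvgZr_tmp; exact: cvg_id].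
have /cf /nbhs_ballP[e e0 he] : nbhs x B by [].
have e2 : 0 < e / 2 by rewrite divr_gt0.
have /he /= Bt : ball (0 : R) e (e / 2).
  by rewrite /ball /= sub0r normrN gtr0_norm//; move: e0 => /=; lra.
have Bx' := interior_subset Bx.
have : dot (x + (e / 2) *: u) u <= sup (shadow B u).
  by apply: ub_le_sup hs.2 _ _; exists (x + (e / 2) *: u).
have : inf (shadow B u) <= dot x u by apply: ge_inf hi.2 _ _; exists x.
by rewrite dotDl dotZl u1 mulr1; lra.
Qed.

End Dot.

(** * Chords of planar sets of constant width *)

Section Planar.
Context {R : realType}.
Implicit Types (K : R -> R -> Prop) (r s t z k : R).

Definition circ t : R := Num.sqrt (1 - t ^+ 2).

Lemma le_circ z t : z ^+ 2 <= 1 - t ^+ 2 -> z <= circ t.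
Proof. by move=> h; apply: le_trans (ler_norm _) _; rewrite -sqrtr_sqr ler_wsqrtr. Qed.

Lemma sqr_le_itv (a b : R) : 0 <= b -> a ^+ 2 <= b ^+ 2 -> - b <= a /\ a <= b.
Proof.
move=> b0; rewrite -(real_normK (num_real a)) ler_sqr ?nnegrE// ler_norml.
by case/andP.
Qed.

Lemma sqr_circ t : -1 <= t <= 1 -> t ^+ 2 + circ t ^+ 2 = 1.
Proof. move=> /andP[t0 t1]; rewrite sqr_sqrtr ?subrKC//.
have : 0 <= (1 - t) * (1 + t) by apply: mulr_ge0; lra.
lra.
Qed.

Lemma between_convex s t z : s <= t <= z ->
  exists l, [/\ 0 <= l, l <= 1 & t = l * s + (1 - l) * z].
Proof.
move=> /andP[st tz]; have [sz|sz] := eqVneq s z.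
  by exists 0; split; lra.
have d : 0 < z - s by rewrite subr_gt0 lt_neqAle sz (le_trans st).
exists ((z - t) / (z - s)); split.
- by rewrite divr_ge0//; lra.
- by rewrite ler_pdivrMr//; lra.
- by field; rewrite gt_eqF.
Qed.

(** The height [circ (t + 2^-1)] of the arc around the opposite base vertex, minus the height
    [circ 2^-1 - circ t] of the arc around the apex. *)
Definition reuleaux_chord t : R := circ t + circ (t + 2^-1) - circ 2^-1.

(** The abscissa is signed: [K] is the whole meridian section, on both sides of the axis. *)
Record symmetric_unit_width K : Prop := {
  suw_convex : forall r z s t l, K r z -> K s t -> 0 <= l -> l <= 1 ->
    K (l * r + (1 - l) * s) (l * z + (1 - l) * t);
  suw_sym : forall r z, K r z -> K (- r) z;
  suw_diam : forall r z s t, K r z -> K s t -> (r - s) ^+ 2 + (z - t) ^+ 2 <= 1;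
  suw_span : forall a b, a ^+ 2 + b ^+ 2 = 1 -> exists r z s t,
    [/\ K r z, K s t, r - s = a & z - t = b] }.

(* Take diameters PQ and P'Q' of K whose horizontal extents are t and t + 1/2.
   By the reflection symmetry and the bound 1 on the diameter, P and P' lie on
   either side of the line r = t, and so do the mirror images of Q and Q'.
   Sliding each of these two pairs to r = t by convexity leaves two
   complementary points which, after a reflection, are at horizontal distance
   1/2, hence at vertical distance at most circ (1/2). *)
Lemma reuleaux_chord_le K t : symmetric_unit_width K -> 0 <= t <= 2^-1 ->
  exists z1 z2, [/\ K t z1, K t z2 & reuleaux_chord t <= z1 - z2].
Proof.
move=> [cK sK dK spK] /andP[t0 t1].
have ct : t ^+ 2 + circ t ^+ 2 = 1 by apply: sqr_circ; apply/andP; split; lra.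
have ct' : (t + 2^-1) ^+ 2 + circ (t + 2^-1) ^+ 2 = 1.
  by apply: sqr_circ; apply/andP; split; lra.
have [x [zp [x' [zq [KP KQ xx' zpq]]]]] := spK _ _ ct.
have [y [zp' [y' [zq' [KP' KQ' yy' zpq']]]]] := spK _ _ ct'.
(* P is within 1 of the mirror image of Q, and their vertical gap is already [circ t]; hence
   [|2 x - t| <= t]. *)
have x0t : 0 <= x <= t.
  have := dK _ _ _ _ KP (sK _ _ KQ); rewrite zpq -ct (_ : x - - x' = 2 * x - t); last by lra.
  move=> h; have [] := @sqr_le_itv (2 * x - t) t t0; lra.
(* Comparing P' and Q' with their own mirror images bounds [|y|] and [|y'|] by 1/2, while
   [y - y' = t + 1/2]. *)
have yt : t <= y <= 2^-1.
  have h1 := dK _ _ _ _ KP' (sK _ _ KP').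
  have h2 := dK _ _ _ _ KQ' (sK _ _ KQ').
  have [_] : -1 <= y - - y /\ y - - y <= 1.
    by apply: sqr_le_itv; [exact: ler01|have := sqr_ge0 (zp' - zp'); lra].
  have [] : -1 <= y' - - y' /\ y' - - y' <= 1.
    by apply: sqr_le_itv; [exact: ler01|have := sqr_ge0 (zq' - zq'); lra].
  lra.
have [l [l0 l1 tl]] : exists l, [/\ 0 <= l, l <= 1 & t = l * x + (1 - l) * y].
  by apply: between_convex; move: x0t yt => /andP[_ ->] /andP[->].
have [m [m0 m1 tm]] : exists l, [/\ 0 <= l, l <= 1 & t = l * (- x') + (1 - l) * (- y')].
  by apply: between_convex; move: x0t yt => /andP[? ?] /andP[? ?]; apply/andP; split; lra.
have KA : K t (l * zp + (1 - l) * zp') by rewrite {1}tl; exact: cK.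
have KC : K t (m * zq + (1 - m) * zq') by rewrite {1}tm; apply: cK => //; exact: sK.
have l0' : 0 <= 1 - l by lra.
have l1' : 1 - l <= 1 by lra.
have m0' : 0 <= 1 - m by lra.
have m1' : 1 - m <= 1 by lra.
have KA' := cK _ _ _ _ _ KP KP' l0' l1'.
have KC' := cK _ _ _ _ _ KQ KQ' m0' m1'.
exists (l * zp + (1 - l) * zp'), (m * zq + (1 - m) * zq'); split => //.
have := dK _ _ _ _ KA' KC'.
(* The totals over both pairs are known: [e = (x - x') + (y - y') - 2 t = 1/2], and [d] plus the
   vertical difference at abscissa [t] is [circ t + circ (t + 1/2)]. *)
set d := (1 - l) * zp + _ - _; set e := (X in X ^+ 2 + _ <= _) => h.
have eE : e = 2^-1 by rewrite /e; lra.
have : d <= circ 2^-1 by apply: le_circ; rewrite -eE; lra.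
rewrite /reuleaux_chord /d; lra.
Qed.

(* For [k ^+ 2 = 3 / 4]: the Reuleaux triangle with base vertices (-1/2, 0) and
   (1/2, 0) and apex (0, k), the two base constraints being merged into one. *)
Definition reuleaux_profile k r z : Prop :=
  r ^+ 2 + (z - k) ^+ 2 <= 1 /\ (`|r| + 2^-1) ^+ 2 + z ^+ 2 <= 1.

Lemma circ_half k : k ^+ 2 = 3 / 4 -> circ 2^-1 = `|k|.
Proof.
by move=> h; rewrite -sqrtr_sqr h; congr Num.sqrt; field.
Qed.

Lemma reuleaux_profile_radius k t z : 0 <= t -> reuleaux_profile k t z -> t <= 2^-1.
Proof.
move=> t0; rewrite /reuleaux_profile ger0_norm// => -[_ h].
have [] : -1 <= t + 2^-1 /\ t + 2^-1 <= 1.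
  by apply: sqr_le_itv; [exact: ler01|have := sqr_ge0 z; lra].
lra.
Qed.

(** For [k >= 0] the apex is on top and the lower boundary is the arc around it; for [k < 0] the
    triangle is upside down and the base arcs bound it from below. *)
Lemma reuleaux_profile_chord k t : k ^+ 2 = 3 / 4 -> 0 <= t ->
  exists lo, forall z, reuleaux_profile k t z -> lo <= z <= lo + reuleaux_chord t.
Proof.
move=> k2 t0; rewrite /reuleaux_chord (circ_half k2).
have [kp|kn] := ger0P k.
- exists (k - circ t) => z; rewrite /reuleaux_profile ger0_norm// => -[h1 h2].
  have : z <= circ (t + 2^-1) by apply: le_circ; lra.
  have : k - z <= circ t by apply: le_circ; rewrite -sqrrN opprB; lra.
  by move=> ? ?; apply/andP; split; lra.
- exists (- circ (t + 2^-1)) => z; rewrite /reuleaux_profile ger0_norm// => -[h1 h2].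
  have : z - k <= circ t by apply: le_circ; lra.
  have : - z <= circ (t + 2^-1) by apply: le_circ; rewrite sqrrN; lra.
  by move=> ? ?; apply/andP; split; lra.
Qed.

Lemma reuleaux_profileN k r z : reuleaux_profile k r z -> reuleaux_profile (- k) r (- z).
Proof. by rewrite /reuleaux_profile -opprD !sqrrN. Qed.

Lemma reuleaux_profile_sym k r z : reuleaux_profile k r z -> reuleaux_profile k (- r) z.
Proof. by rewrite /reuleaux_profile sqrrN normrN. Qed.

(** The sum [|r| + |s|] is the largest horizontal distance reached when the two points turn about
    the axis, so this also bounds the diameter of the rotated body. *)
Lemma reuleaux_profile_diam k r z s t : k ^+ 2 = 3 / 4 ->
  reuleaux_profile k r z -> reuleaux_profile k s t ->
  (`|r| + `|s|) ^+ 2 + (z - t) ^+ 2 <= 1.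
Proof.
wlog k0 : k z t / 0 <= k => [th|].
  have [|kn] := lerP 0 k; first exact: th.
  move=> k2 /reuleaux_profileN h1 /reuleaux_profileN h2.
  have := th (- k) (- z) (- t) _ _ h1 h2; rewrite sqrrN -opprD sqrrN; apply => //; lra.
wlog zt : r z s t / t <= z => [th|].
  have [|zt] := lerP t z; first exact: th.
  move=> k2 h1 h2; rewrite addrC (addrC `|r|) -sqrrN opprB addrC; apply: th => //; exact: ltW.
rewrite /reuleaux_profile -(real_normK (num_real r)) -(real_normK (num_real s)).
move: (normr_ge0 r) (normr_ge0 s); move: `|r| `|s| => {}r {}s r0 s0 k2 [h1 h2] [h3 h4].
have kh : 2^-1 <= k by rewrite -ler_sqr ?nnegrE ?k2; lra.
set a := r + s; set b := z - t.
have a0 : 0 <= a by rewrite /a; lra.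
have b0 : 0 <= b by rewrite /b; lra.
(* The direction (a, b) points into the angle at the vertex (-1/2, 0) when
   b <= 2 k a, and its opposite into the angle at (0, k) otherwise. *)
suff : a ^+ 2 + b ^+ 2 <= Num.sqrt (a ^+ 2 + b ^+ 2).
  set q := a ^+ 2 + b ^+ 2 => hq.
  have q0 : 0 <= q by rewrite addr_ge0 ?sqr_ge0.
  have := sqr_sqrtr q0; move: (Num.sqrt q) hq => v qv vq.
  suff : v <= 1 by lra.
  rewrite leNgt; apply/negP => v1; have : 0 < v * (v - 1) by apply: mulr_gt0; lra.
  lra.
have [ab|ab] := lerP b (2 * k * a).
- have hP : a * (r + 2^-1) + b * z <= Num.sqrt (a ^+ 2 + b ^+ 2).
    apply: le_trans (ler_norm _) _; rewrite -sqrtr_sqr ler_wsqrtr//.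
    have := sqr_ge0 (a * z - b * (r + 2^-1)).
    have : 0 <= (a ^+ 2 + b ^+ 2) * (1 - ((r + 2^-1) ^+ 2 + z ^+ 2)).
      by apply: mulr_ge0; [rewrite addr_ge0 ?sqr_ge0|lra].
    lra.
  (* Seen from the vertex (-1/2, 0), the point (-s, t) has nonnegative products with (1, 0) and
     (1/2, k), the extreme directions of the angle, and 2 k (a, b) is a nonnegative combination of
     these two. *)
  have hQ : 0 <= a * (2^-1 - s) + b * t.
    have e1 : 0 <= 2^-1 - s.
      have [] : -1 <= s + 2^-1 /\ s + 2^-1 <= 1.
        by apply: sqr_le_itv; [exact: ler01|have := sqr_ge0 t; lra].
      lra.
    have e2 : 0 <= 2^-1 * (2^-1 - s) + k * t by have := sqr_ge0 (s - 2^-1); have := sqr_ge0 t; lra.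
    rewrite -(pmulr_rge0 _ (_ : 0 < 2 * k)); last lra.
    have -> : 2 * k * (a * (2^-1 - s) + b * t) =
      (2 * k * a - b) * (2^-1 - s) + 2 * b * (2^-1 * (2^-1 - s) + k * t) by field.
    by rewrite addr_ge0// mulr_ge0//; lra.
  have qE : a ^+ 2 + b ^+ 2 = a * (r + 2^-1) + b * z - (a * (2^-1 - s) + b * t).
    by rewrite /a /b; ring.
  lra.
- have hQ : a * s + b * (k - t) <= Num.sqrt (a ^+ 2 + b ^+ 2).
    apply: le_trans (ler_norm _) _; rewrite -sqrtr_sqr ler_wsqrtr//.
    have := sqr_ge0 (a * (k - t) - b * s).
    have : 0 <= (a ^+ 2 + b ^+ 2) * (1 - (s ^+ 2 + (t - k) ^+ 2)).
      by apply: mulr_ge0; [rewrite addr_ge0 ?sqr_ge0|lra].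
    lra.
  (* Here (a, b) is a nonnegative combination of (0, 1) and (1/2, k). *)
  have hP : 0 <= b * (k - z) - a * r.
    have e : 0 <= k * (k - z) - r / 2 by have := sqr_ge0 (z - k); have := sqr_ge0 r; lra.
    have kz : 0 <= k - z by rewrite -(pmulr_rge0 _ (_ : 0 < k)); lra.
    have -> : b * (k - z) - a * r =
      (b - 2 * k * a) * (k - z) + 2 * a * (k * (k - z) - r / 2) by field.
    by rewrite addr_ge0// mulr_ge0//; lra.
  have qE : a ^+ 2 + b ^+ 2 = a * s + b * (k - t) - (b * (k - z) - a * r).
    by rewrite /a /b; ring.
  lra.
Qed.

(** After symmetries and exchange of the endpoints, [a], [b] and [k] are nonnegative. The diameter
    then issues from the vertex (-1/2, 0) if [a >= 1/2] and from the apex otherwise, and ends on the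
    opposite arc. *)
Lemma reuleaux_profile_span k a b : k ^+ 2 = 3 / 4 -> a ^+ 2 + b ^+ 2 = 1 ->
  exists r z s t, [/\ reuleaux_profile k r z, reuleaux_profile k s t, r - s = a & z - t = b].
Proof.
wlog k0 : k b / 0 <= k => [th|].
  have [|kn] := lerP 0 k; first exact: th.
  move=> k2 ab; have [|||r [z [s [t [h1 h2 ra zb]]]]] := th (- k) (- b);
    rewrite ?sqrrN//; first lra.
  exists r, (- z), s, (- t); split => //; last lra.
    by rewrite -(opprK k); exact: reuleaux_profileN.
  by rewrite -(opprK k); exact: reuleaux_profileN.
wlog a0 : a / 0 <= a => [th|].
  have [|an] := lerP 0 a; first exact: th.
  move=> k2 ab; have [||r [z [s [t [h1 h2 ra zb]]]]] := th (- a) _ k2; rewrite ?sqrrN//; first lra.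
  exists (- r), z, (- s), t; split => //; last lra.
    exact: reuleaux_profile_sym.
  exact: reuleaux_profile_sym.
wlog b0 : b / 0 <= b => [th|].
  have [|bn] := lerP 0 b; first exact: th.
  move=> k2 ab; have [||r [z [s [t [h1 h2 ra zb]]]]] := th (- b) _ k2; rewrite ?sqrrN//; first lra.
  exists (- s), t, (- r), z; split => //; try lra.
    exact: reuleaux_profile_sym.
  exact: reuleaux_profile_sym.
move=> k2 ab.
have a1 : a <= 1.
  have [] : -1 <= a /\ a <= 1 by apply: sqr_le_itv; [exact: ler01|have := sqr_ge0 b; lra].
  lra.
have b1 : b <= 1.
  have [] : -1 <= b /\ b <= 1 by apply: sqr_le_itv; [exact: ler01|have := sqr_ge0 a; lra].
  lra.
have kh : 2^-1 <= k by rewrite -ler_sqr ?nnegrE ?k2; lra.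
have [ah|ah] := lerP 2^-1 a.
- exists (a - 2^-1), b, (- 2^-1), 0; split; try lra.
  + split; last by rewrite ger0_norm ?subrK; lra.
    have : 0 <= a * (1 - a) by apply: mulr_ge0; lra.
    have : 0 <= b * (1 - b) by apply: mulr_ge0; lra.
    have : 0 <= b * (k - 2^-1) by apply: mulr_ge0; lra.
    lra.
  + rewrite /reuleaux_profile normrN ger0_norm ?invr_ge0//; split; lra.
- exists 0, k, (- a), (k - b); split; try lra.
  + rewrite /reuleaux_profile normr0; split; lra.
  + rewrite /reuleaux_profile normrN ger0_norm//; split; first lra.
    have : 1 + a <= 2 * k * b.
      rewrite -ler_sqr ?nnegrE; [|lra|by rewrite !mulr_ge0].
      have -> : (2 * k * b) ^+ 2 = 4 * k ^+ 2 * b ^+ 2 by ring.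
      rewrite k2 (_ : b ^+ 2 = 1 - a ^+ 2); last by rewrite -ab addrC addKr.
      have : 0 <= (1 + a) * (2 - 4 * a) by apply: mulr_ge0; lra.
      lra.
    lra.
Qed.
End Planar.

(** * Similarities adapted to an axis *)

Section Frame.
Context {R : realType}.
Implicit Types (x y p n u v : 'rV[R]_3) (w : R) (B : set 'rV[R]_3).

Lemma dot3E x y : dot x y = x 0 0 * y 0 0 + x 0 1 * y 0 1 + x 0 2 * y 0 2.
Proof. exact: big_ord3. Qed.

Definition cross x y : 'rV[R]_3 :=
  row3 (x 0 1 * y 0 2 - x 0 2 * y 0 1, x 0 2 * y 0 0 - x 0 0 * y 0 2,
        x 0 0 * y 0 1 - x 0 1 * y 0 0).

Definition frame n u : 'M[R]_3 :=
  \matrix_(i < 3) (if i == 0 then n else if i == 1 then cross u n else u).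

Definition orthonormal n u := [/\ dot n n = 1, dot u u = 1 & dot n u = 0].

Lemma frame_orthogonal n u : orthonormal n u -> frame n u *m (frame n u)^T = 1%:M.
Proof.
move=> [n1 u1 nu].
have E i j : (frame n u *m (frame n u)^T) i j = dot (row i (frame n u)) (row j (frame n u)).
  by rewrite mxE; apply: eq_bigr => k _; rewrite !mxE.
have cu : dot (cross u n) u = 0 by rewrite dot3E !row3E /=; ring.
have cn : dot (cross u n) n = 0 by rewrite dot3E !row3E /=; ring.
have cc : dot (cross u n) (cross u n) = 1.
  have -> : dot (cross u n) (cross u n) = dot u u * dot n n - dot n u ^+ 2.
    by rewrite !dot3E !row3E /=; ring.
  by rewrite n1 u1 nu; ring.
by apply/matrixP; apply: ord3P; apply: ord3P; rewrite E !rowK mxE //= dotC.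
Qed.

Lemma frame_row2 n u : row 2 (frame n u) = u.
Proof. by rewrite rowK. Qed.

Lemma exists_orthonormal u : dot u u = 1 -> exists n, orthonormal n u.
Proof.
move=> u1; set d := u 0 0 ^+ 2 + u 0 1 ^+ 2.
have [d0|d0] := eqVneq d 0.
  have [u0 u0'] : u 0 0 = 0 /\ u 0 1 = 0.
    by move: d0; rewrite /d => /eqP; rewrite paddr_eq0 ?sqr_ge0// !sqrf_eq0 => /andP[/eqP ? /eqP ?].
  by exists (row3 (1, 0, 0)); split=> //; rewrite dot3E !row3E /= ?u0; ring.
have dp : 0 < d by rewrite lt_neqAle eq_sym d0 addr_ge0 ?sqr_ge0.
exists ((Num.sqrt d)^-1 *: row3 (- u 0 1, u 0 0, 0)); split=> //.
  rewrite dotZl dotZr mulrA -expr2 exprVn sqr_sqrtr ?ltW// dot3E !row3E /=.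
  rewrite (_ : _ + _ = d); first by rewrite mulVf.
  by rewrite /d; ring.
by rewrite dotZl dot3E !row3E /=; ring.
Qed.

(** For orthonormal [n], [u] and [w > 0], the similarity that carries the third coordinate axis to
    the line through [p] along [u] and length 1 to [w]. Bodies are studied through their preimages
    under it. *)
Definition placement p w n u x : 'rV[R]_3 := p + x *m (w *: frame n u).

Section Placement.
Variables (p n u : 'rV[R]_3) (w : R).
Hypotheses (nu : orthonormal n u) (w0 : 0 < w).
Let M := frame n u.
Let Phi := placement p w n u.
Let MM : M *m M^T = 1%:M. Proof. exact: frame_orthogonal. Qed.
Let MM' : M^T *m M = 1%:M. Proof. exact: mulmx1C. Qed.
Let wn0 : w != 0. Proof. by rewrite gt_eqF. Qed.

Definition placement_inv x : 'rV[R]_3 := w^-1 *: ((x - p) *m M^T).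

Lemma placementK : cancel Phi placement_inv.
Proof.
move=> x; rewrite /placement_inv /Phi /placement addrC addKr -scalemxAr -scalemxAl.
by rewrite scalerA mulVf// scale1r -mulmxA MM mulmx1.
Qed.

Lemma placement_invK : cancel placement_inv Phi.
Proof.
move=> x; rewrite /placement_inv /Phi /placement -scalemxAr -scalemxAl scalerA.
by rewrite mulfV// scale1r -mulmxA MM' mulmx1 addrC subrK.
Qed.

Lemma placementB x y : Phi x - Phi y = w *: ((x - y) *m M).
Proof.
by rewrite /Phi /placement opprD addrACA subrr add0r -mulmxBl -scalemxAr.
Qed.

Lemma placement_dist x y :
  dot (Phi x - Phi y) (Phi x - Phi y) = w ^+ 2 * dot (x - y) (x - y).
Proof. by rewrite placementB dotZl dotZr dot_mulmx// mulrA. Qed.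

Lemma placement_edist_le x y :
  (edist (Phi x) (Phi y) <= w) = (dot (x - y) (x - y) <= 1).
Proof.
rewrite (ler_edist _ _ (ltW w0)) placement_dist -[leRHS]mulr1 ler_pM2l//.
by rewrite exprn_gt0.
Qed.

Lemma placement_edist_eq x y :
  edist (Phi x) (Phi y) = w -> dot (x - y) (x - y) = 1.
Proof.
move=> h; have := edist_sqr (Phi x) (Phi y); rewrite h placement_dist.
by rewrite -[LHS]mulr1 => /mulfI -> //; rewrite expf_neq0.
Qed.

Lemma placement_convex (l : R) x y :
  l *: Phi x + (1 - l) *: Phi y = Phi (l *: x + (1 - l) *: y).
Proof.
rewrite /Phi /placement mulmxDl -!scalemxAl !scalerDr addrACA -scalerDl.
by rewrite subrKC scale1r.
Qed.

Lemma diametral_placement B : diametral (Phi @^-1` B) 1 <-> diametral B w.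
Proof.
have w2 : 0 < w ^+ 2 by rewrite exprn_gt0.
split=> -[dB sB]; split.
- move=> x y Bx By; rewrite -(placement_invK x) -(placement_invK y). rewrite placement_dist.
  rewrite -[leRHS]mulr1 ler_pM2l// -(expr1n _ 2); apply: dB; by rewrite /preimage /= placement_invK.
- move=> v v1; have /sB[x [y [Bx By xy]]] : dot (v *m M^T) (v *m M^T) = 1.
    by rewrite dot_mulmx ?trmxK.
  exists (Phi x), (Phi y); split => //.
  by rewrite placementB xy scale1r -mulmxA MM' mulmx1.
- move=> x y Bx By; rewrite expr1n -(ler_pM2l w2) -placement_dist mulr1; exact: dB.
- move=> v v1; have /sB[x [y [Bx By xy]]] : dot (v *m M) (v *m M) = 1 by rewrite dot_mulmx.
  exists (placement_inv x), (placement_inv y).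
  rewrite /preimage /= !placement_invK; split => //.
  rewrite /placement_inv -scalerBr -mulmxBl opprB addrA subrK xy.
  by rewrite -scalemxAl scalerA mulVf// -mulmxA MM mulmx1.
Qed.

Lemma mulmx_continuous (A : 'M[R]_3) : continuous (fun x : 'rV[R]_3 => x *m A).
Proof.
under eq_fun do rewrite mulmx_sum_row.
apply: continuous_big => [|i _ x]; first exact: add_continuous.
exact: (cvgZr_tmp (a := row i A) (@coord_continuous R 1 3 0 i x)).
Qed.

Lemma placement_continuous : continuous Phi.
Proof.
move=> x; exact: (cvgD (cvg_cst p) (@mulmx_continuous (w *: M) x)).
Qed.

Lemma placement_inv_continuous : continuous placement_inv.
Proof.
have -> : placement_inv = fun x => - (p *m (w^-1 *: M^T)) + x *m (w^-1 *: M^T).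
  by apply/funext => x; rewrite /placement_inv scalemxAr mulmxBl addrC.
move=> x; exact: (cvgD (cvg_cst _) (@mulmx_continuous (w^-1 *: M^T) x)).
Qed.

Lemma placement_volume B : closed B ->
  volume B = (volume (Phi @^-1` B) * (w ^+ 3)%:E)%E.
Proof.
move=> cB; have dM : `|\det M| = 1.
  have : \det M ^+ 2 = 1 by have := congr1 determinant MM; rewrite det_mulmx det_tr det1 -expr2.
  by move/eqP; rewrite sqrf_eq1 => /orP[] /eqP ->; rewrite ?normrN normr1.
have dwM : `|\det (w *: M)| = w ^+ 3 by rewrite detZ normrM dM mulr1 ger0_norm// exprn_ge0// ltW.
rewrite -(@volume_affine_preimage _ (w *: M) p B) ?dwM//.
  by rewrite unitmxE unitfE -normr_gt0 dwM exprn_gt0.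
exact: closed_measurable_row3.
Qed.

Lemma placement_axis x : dot (Phi x - p) u = w * x 0 2.
Proof.
rewrite /Phi /placement addrC addKr -scalemxAr dotZl; congr (_ * _).
have uM : u = delta_mx 0 2 *m M by rewrite -rowE frame_row2.
by rewrite -/M [X in dot _ X]uM dot_mulmx// dot3E !mxE /=; ring.
Qed.

(** * Rotations in cylindrical coordinates *)

Definition radius x : R := Num.sqrt (x 0 0 ^+ 2 + x 0 1 ^+ 2).

Lemma sqr_radius x : radius x ^+ 2 = x 0 0 ^+ 2 + x 0 1 ^+ 2.
Proof. by rewrite sqr_sqrtr// addr_ge0 ?sqr_ge0. Qed.

Lemma radius_ge0 x : 0 <= radius x.
Proof. exact: sqrtr_ge0. Qed.

Lemma rotation_radius f x y : rotation_about p u f -> Phi y = f (Phi x) ->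
  radius y = radius x /\ y 0 2 = x 0 2.
Proof.
move=> [A [AA dA uA fE]] yx.
have h : Phi y - p = (Phi x - p) *m A by rewrite yx fE addrC addKr.
have z : y 0 2 = x 0 2.
  by apply: (mulfI wn0); rewrite -!placement_axis h -{1}uA dot_mulmx.
split => //; congr Num.sqrt.
have E q : dot (Phi q - p) (Phi q - p) = w ^+ 2 * dot q q.
  have := placement_dist q 0; rewrite subr0 (_ : Phi 0 = p) //.
  by rewrite /Phi /placement mul0mx addr0.
have : dot y y = dot x x.
  by apply: (@mulfI _ (w ^+ 2)); rewrite ?expf_neq0// -!E h dot_mulmx.
rewrite !dot3E z; lra.
Qed.

(** Together with [rotation_radius], this identifies the orbits of the rotations with the level sets
    of radius and height. *)
Lemma radius_rotation x y : radius y = radius x -> y 0 2 = x 0 2 ->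
  exists2 f, rotation_about p u f & Phi y = f (Phi x).
Proof.
move=> rxy zxy.
have /= sxy := congr1 (fun r => r ^+ 2) rxy; rewrite !sqr_radius in sxy.
(* Cosine and sine of the angle between the horizontal parts; on the axis the identity is chosen. *)
have [c [s [cs y0 y1]]] : exists c s, [/\ c ^+ 2 + s ^+ 2 = 1,
    y 0 0 = c * x 0 0 - s * x 0 1 & y 0 1 = s * x 0 0 + c * x 0 1].
  have [d0|d0] := eqVneq (x 0 0 ^+ 2 + x 0 1 ^+ 2) 0.
    exists 1, 0; move: sxy; rewrite d0 => /eqP; move/eqP: d0.
    rewrite !paddr_eq0 ?sqr_ge0// !sqrf_eq0.
    move=> /andP[/eqP -> /eqP ->] /andP[/eqP -> /eqP ->]; split; ring.
  exists ((x 0 0 * y 0 0 + x 0 1 * y 0 1) / (x 0 0 ^+ 2 + x 0 1 ^+ 2)),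
    ((x 0 0 * y 0 1 - x 0 1 * y 0 0) / (x 0 0 ^+ 2 + x 0 1 ^+ 2)).
  split; [|by field|by field].
  have E : (x 0 0 * y 0 0 + x 0 1 * y 0 1) ^+ 2 + (x 0 0 * y 0 1 - x 0 1 * y 0 0) ^+ 2 =
      (x 0 0 ^+ 2 + x 0 1 ^+ 2) ^+ 2.
    by rewrite expr2 -[X in _ = X * _]sxy; ring.
  by rewrite !expr_div_n -mulrDl E mulfV// expf_neq0.
pose G : 'M[R]_3 := \matrix_(i < 3) row3 (if i == 0 then (c, s, 0)
  else if i == 1 then (- s, c, 0) else (0, 0, 1)).
have GG : G *m G^T = 1%:M.
  apply/matrixP; apply: ord3P; apply: ord3P;
    rewrite mxE big_ord3 !mxE /= ?mulr1n ?mulr0n; lra.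
have dG : \det G = 1.
  rewrite (expand_det_row _ 0) big_ord3 /cofactor !(expand_det_row _ 0) !big_ord_recl !big_ord0.
  rewrite /cofactor !det_mx11 !mxE /= !mul0r !addr0 modn_small// !add0n expr0 expr1.
  by rewrite -[RHS]cs; ring.
have xG : y = x *m G.
  by apply/rowP; apply: ord3P; rewrite !mxE big_ord3 !mxE /= ?y0 ?y1 ?zxy; ring.
exists (fun z => p + (z - p) *m (M^T *m G *m M)).
  exists (M^T *m G *m M); split => //.
  - rewrite !trmx_mul trmxK !mulmxA -(mulmxA (M^T *m G)) MM mulmx1.
    by rewrite -(mulmxA M^T) GG mulmx1 MM'.
  - rewrite !det_mulmx dG mulr1 -det_mulmx MM' det1//.
  - have uM : u = delta_mx 0 2 *m M by rewrite -rowE frame_row2.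
    rewrite {1}uM !mulmxA -(mulmxA _ M) MM mulmx1 -rowE.
    rewrite (_ : row 2 G = delta_mx 0 2) -?uM//.
    by apply/rowP; apply: ord3P; rewrite !mxE.
rewrite xG /Phi /placement -/M (_ : p + x *m (w *: M) - p = x *m (w *: M)); last first.
  by rewrite addrAC subrr add0r.
rewrite -!scalemxAr -!scalemxAl !mulmxA.
by rewrite -(mulmxA x M) MM mulmx1.
Qed.

End Placement.
End Frame.

(** * Comparison of volumes by vertical sections *)

Section RevolutionBodies.
Context {R : realType}.
Implicit Types (x y p n u v : 'rV[R]_3) (r s t z k w l : R) (B H : set 'rV[R]_3).

Lemma convex_setP B : convex_set B <->
  forall x y l, B x -> B y -> 0 <= l -> l <= 1 -> B (l *: x + (1 - l) *: y).
Proof.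
split=> [cB x y l Bx By l0 l1|cB].
  by apply/set_mem; apply: (cB x y (Itv01 l0 l1)); exact: mem_set.
by move=> x y l /set_mem Bx /set_mem By; apply/mem_set; exact: cB.
Qed.

Lemma radius_row3 r z : radius (row3 (r, 0, z)) = `|r|.
Proof. by rewrite /radius !row3E /= expr0n addr0 sqrtr_sqr. Qed.

Lemma row3_convex (q q' : R * R * R) l : l *: row3 q + (1 - l) *: row3 q' =
  row3 (l * q.1.1 + (1 - l) * q'.1.1, l * q.1.2 + (1 - l) * q'.1.2,
        l * q.2 + (1 - l) * q'.2).
Proof. by apply/rowP; apply: ord3P; rewrite row3E !mxE /=. Qed.

Lemma row3B (q q' : R * R * R) :
  row3 q - row3 q' = row3 (q.1.1 - q'.1.1, q.1.2 - q'.1.2, q.2 - q'.2).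
Proof. by apply/rowP; apply: ord3P; rewrite row3E !mxE /=. Qed.

Definition radial H := forall x y, radius y = radius x -> y 0 2 = x 0 2 -> H x -> H y.

Definition profile H r z := H (row3 (r, 0, z)).

Lemma radial_profile H x : radial H -> H x <-> profile H (radius x) (x 0 2).
Proof.
move=> rH; split; apply: rH; rewrite ?radius_row3 ?row3_2// ger0_norm// radius_ge0//.
Qed.

(** The midpoint of a point and its mirror image in the meridian plane is its projection to that
    plane, so [H] contains its own projection. Spatial diameters parallel to the plane thus project
    to diameters of the section. *)
Lemma profile_symmetric_unit_width H : convex_set H -> radial H -> diametral H 1 ->
  symmetric_unit_width (profile H).
Proof.
move=> /convex_setP cH rH [dH sH].
have proj x : H x -> profile H (x 0 0) (x 0 2).
  move=> Hx; have Hx' : H (row3 (x 0 0, - x 0 1, x 0 2)).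
    by apply: rH Hx; rewrite ?row3_2// /radius !row3E /= sqrrN.
  rewrite /profile.
  have -> : row3 (x 0 0, 0, x 0 2) =
      2^-1 *: x + (1 - 2^-1) *: row3 (x 0 0, - x 0 1, x 0 2).
    by apply/rowP; apply: ord3P; rewrite row3E !mxE /=; field.
  by apply: cH => //; lra.
split.
- move=> r z s t l Kr Ks l0 l1; have := cH _ _ _ Kr Ks l0 l1.
  by rewrite row3_convex /= !mulr0 addr0.
- by move=> r z; apply: rH; rewrite ?row3_2// !radius_row3 normrN.
- move=> r z s t Kr Ks; have := dH _ _ Kr Ks.
  by rewrite row3B dot3E !row3E /= subr0 mulr0 addr0 expr1n !expr2.
- move=> a b ab; have /sH[x [y [/proj Hx /proj Hy xy]]] : dot (row3 (a, 0, b)) (row3 (a, 0, b)) = 1.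
    by rewrite dot3E !row3E /= mulr0 addr0 -!expr2.
  exists (x 0 0), (x 0 2), (y 0 0), (y 0 2); split => //.
    by have := congr1 (fun x => x 0 0) xy; rewrite scale1r row3E !mxE.
  by have := congr1 (fun x => x 0 2) xy; rewrite scale1r row3E !mxE.
Qed.

Lemma le_volume_sections H H' : closed H -> closed H' ->
  (forall a b, lebesgue_measure [set z | H (row3 (a, b, z))] <=
               lebesgue_measure [set z | H' (row3 (a, b, z))])%E ->
  (volume H <= volume H')%E.
Proof.
move=> cH cH' le; have mH := closed_measurable_row3 cH.
have mH' := closed_measurable_row3 cH'.
apply: (@ge0_le_integral _ _ _ (@lebesgue2 R)) => //=.
- exact: measurable_fun_xsection.
- exact: measurable_fun_xsection.
- by move=> [a b] _; rewrite /= !xsectionE; exact: le.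
Qed.

Lemma le_volume_reuleaux k z0 H H' : k ^+ 2 = 3 / 4 -> closed H -> closed H' ->
  (forall x, H x -> reuleaux_profile k (radius x) (x 0 2 - z0)) ->
  convex_set H' -> radial H' -> diametral H' 1 ->
  (volume H <= volume H')%E.
Proof.
move=> k2 cH cH' HE xH' rH' dH'; apply: le_volume_sections => // a b.
have mS (G : set 'rV[R]_3) : closed G ->
    measurable ([set z | G (row3 (a, b, z))] : set (measurableTypeR R)).
  by move=> /closed_measurable_row3 /(@measurable_xsection _ _ _ _ _ (a, b)); rewrite xsectionE.
set t := Num.sqrt (a ^+ 2 + b ^+ 2).
have tE z : radius (row3 (a, b, z)) = t by rewrite /radius !row3E.
have t0 : 0 <= t by exact: sqrtr_ge0.
(* The chord bound is available for [t <= 1/2] only; a nonempty section of [H] guarantees this. *)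
have [->|/set0P[z1 Hz1]] := eqVneq [set z | H (row3 (a, b, z))] set0.
  by rewrite measure0 measure_ge0.
have t1 : t <= 2^-1.
  by have := HE _ Hz1; rewrite tE => /reuleaux_profile_radius; exact.
have [lo hlo] := reuleaux_profile_chord k2 t0.
have t01 : 0 <= t <= 2^-1 by rewrite t0.
have suw := profile_symmetric_unit_width xH' rH' dH'.
have [s1 [s2 [K1 K2 hs]]] := reuleaux_chord_le suw t01.
apply: (@le_trans _ _ (lebesgue_measure (`[lo + z0, lo + z0 + reuleaux_chord t]%classic : set R))).
  apply: le_measure; rewrite ?inE//; first exact: mS.
  have h z : H (row3 (a, b, z)) -> lo + z0 <= z <= lo + z0 + reuleaux_chord t.
    by move=> /HE; rewrite tE row3_2 /= => /hlo /andP[h1 h2]; apply/andP; split; lra.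
  by move=> z Hz; rewrite /= in_itv/=; exact: h.
apply: (@le_trans _ _ (lebesgue_measure (`[s2, s1]%classic : set R))).
  rewrite !lebesgue_measure_itv/= !lte_fin; case: ifPn => [h|_]; last first.
    by case: ifPn => // h; rewrite -EFinD lee_fin; lra.
  by rewrite ifT; [rewrite -!EFinD lee_fin; lra|lra].
apply: le_measure; rewrite ?inE//; first exact: mS.
move=> z; rewrite /= in_itv/= => h.
apply/(radial_profile _ rH'); rewrite tE row3_2 /=.
have [l [l0 l1 zE]] := between_convex h.
have := suw_convex suw K2 K1 l0 l1; rewrite -zE.
by have -> : l * t + (1 - l) * t = t by ring.
Qed.
End RevolutionBodies.

(** * The rotated Reuleaux triangle *)

Section ReuleauxBody.
Context {R : realType}.
Implicit Types (x y p n u v : 'rV[R]_3) (r s t z k w l : R) (B H : set 'rV[R]_3).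

Definition reuleaux_body k z0 : set 'rV[R]_3 :=
  [set x | reuleaux_profile k (radius x) (x 0 2 - z0)].

Lemma reuleaux_body_radial k z0 : radial (reuleaux_body k z0).
Proof. by move=> x y rxy zxy; rewrite /reuleaux_body /= rxy zxy. Qed.

Lemma radius_cauchy x y : x 0 0 * y 0 0 + x 0 1 * y 0 1 <= radius x * radius y.
Proof.
apply: le_trans (ler_norm _) _; rewrite -sqrtr_sqr -sqrtrM ?addr_ge0 ?sqr_ge0//.
by rewrite ler_wsqrtr//; have := sqr_ge0 (x 0 0 * y 0 1 - x 0 1 * y 0 0); lra.
Qed.

Lemma radius_convex x y l : 0 <= l -> l <= 1 ->
  radius (l *: x + (1 - l) *: y) <= l * radius x + (1 - l) * radius y.
Proof.
move=> l0 l1; have l1' : 0 <= 1 - l by rewrite subr_ge0.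
rewrite -ler_sqr ?nnegrE ?radius_ge0 ?addr_ge0 ?mulr_ge0 ?radius_ge0//.
have -> : (l * radius x + (1 - l) * radius y) ^+ 2 =
    l ^+ 2 * (x 0 0 ^+ 2 + x 0 1 ^+ 2) + 2 * l * (1 - l) * (radius x * radius y) +
    (1 - l) ^+ 2 * (y 0 0 ^+ 2 + y 0 1 ^+ 2) by rewrite -!sqr_radius; ring.
rewrite sqr_radius !mxE.
have : 0 <= l * (1 - l) * (radius x * radius y - (x 0 0 * y 0 0 + x 0 1 * y 0 1)).
  by rewrite !mulr_ge0// subr_ge0 radius_cauchy.
by lra.
Qed.

Lemma sqr_sum_convex (a b c d e l : R) : 0 <= l -> l <= 1 -> 0 <= c ->
  c <= l * a + (1 - l) * b ->
  c ^+ 2 + (l * d + (1 - l) * e) ^+ 2 <= l * (a ^+ 2 + d ^+ 2) + (1 - l) * (b ^+ 2 + e ^+ 2).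
Proof.
move=> l0 l1 c0 cab.
have h : c ^+ 2 <= (l * a + (1 - l) * b) ^+ 2.
  by rewrite ler_sqr// nnegrE//; apply: le_trans cab.
have : 0 <= l * (1 - l) * ((a - b) ^+ 2 + (d - e) ^+ 2).
  by rewrite !mulr_ge0 ?subr_ge0 ?addr_ge0 ?sqr_ge0.
by lra.
Qed.

(** The radius is convex and nonnegative, so its square and that of radius + 1/2 are convex; both
    constraints are sublevel sets of convex functions. *)
Lemma reuleaux_body_convex k z0 : convex_set (reuleaux_body k z0).
Proof.
apply/convex_setP => x y l; rewrite /reuleaux_body /= /reuleaux_profile.
rewrite !ger0_norm ?radius_ge0// => -[h1 h2] [h3 h4] l0 l1.
have rc := radius_convex x y l0 l1.
have l1' : 0 <= 1 - l by rewrite subr_ge0.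
have c a b : a <= 1 -> b <= 1 -> l * a + (1 - l) * b <= 1.
  move=> a1 b1; have : 0 <= l * (1 - a) by rewrite mulr_ge0// subr_ge0.
  have : 0 <= (1 - l) * (1 - b) by rewrite mulr_ge0// subr_ge0.
  lra.
rewrite !mxE; split.
- apply: le_trans (c _ _ h1 h3); rewrite (_ : _ - k =
    l * (x 0 2 - z0 - k) + (1 - l) * (y 0 2 - z0 - k)); last by ring.
  by apply: sqr_sum_convex => //; exact: radius_ge0.
- apply: le_trans (c _ _ h2 h4); rewrite (_ : _ - z0 =
    l * (x 0 2 - z0) + (1 - l) * (y 0 2 - z0)); last by ring.
  apply: sqr_sum_convex => //; last by lra.
  by rewrite addr_ge0 ?radius_ge0.
Qed.

(** The horizontal distance of two points is at most the sum of their radii, and every direction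
    lies in some meridian plane, where the planar diameters are available. *)
Lemma reuleaux_body_diametral k z0 : k ^+ 2 = 3 / 4 -> diametral (reuleaux_body k z0) 1.
Proof.
move=> k2; split.
- move=> x y Bx By; have := reuleaux_profile_diam k2 Bx By.
  rewrite !ger0_norm ?radius_ge0// expr1n; apply: le_trans.
  have : radius (- y) = radius y by rewrite /radius !mxE !sqrrN.
  have := radius_cauchy x (- y) => + E; rewrite E.
  rewrite dot3E sqrrD !sqr_radius !mxE; lra.
- move=> v v1.
  have ab : radius v ^+ 2 + (v 0 2) ^+ 2 = 1 by rewrite sqr_radius !expr2 -dot3E.
  have [r [z [s [t [h1 h2 rs zt]]]]] := reuleaux_profile_span k2 ab.
  have [c [d [cd v0 v1']]] : exists c d, [/\ c ^+ 2 + d ^+ 2 = 1,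
      v 0 0 = radius v * c & v 0 1 = radius v * d].
    have [r0|r0] := eqVneq (radius v) 0.
      exists 1, 0; split; first by ring.
      - have := sqr_radius v; rewrite r0 expr0n => /esym/eqP.
        by rewrite paddr_eq0 ?sqr_ge0// !sqrf_eq0 => /andP[/eqP -> _]; rewrite mul0r.
      - have := sqr_radius v; rewrite r0 expr0n => /esym/eqP.
        by rewrite paddr_eq0 ?sqr_ge0// !sqrf_eq0 => /andP[_ /eqP ->]; rewrite mul0r.
    exists (v 0 0 / radius v), (v 0 1 / radius v); split; [|by field|by field].
    by rewrite !expr_div_n -mulrDl -sqr_radius mulfV// expf_neq0.
  have rad q h : radius (row3 (q * c, q * d, h)) = `|q|.
    by rewrite /radius !row3E /= !exprMn -mulrDr cd mulr1 sqrtr_sqr.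
  have lift q h : reuleaux_profile k q h -> reuleaux_body k z0 (row3 (q * c, q * d, h + z0)).
    rewrite /reuleaux_body /= rad row3_2 /= addrK /reuleaux_profile normr_id.
    by rewrite real_normK ?num_real.
  exists (row3 (r * c, r * d, z + z0)), (row3 (s * c, s * d, t + z0)).
  split; [exact: lift|exact: lift|].
  rewrite row3B scale1r /= -!mulrBl rs; apply/rowP; apply: ord3P; rewrite row3E //=.
  by rewrite -zt; ring.
Qed.

(** * Topology of the rotated triangle *)

Let coordc i : continuous (fun x => x 0 i : R).
Proof. exact: coord_continuous. Qed.

Let add_cont (f g : 'rV[R]_3 -> R) : continuous f -> continuous g ->
  continuous (fun x => f x + g x).
Proof. by move=> cf cg x; apply: (@continuousD _ R _ f g); [exact: cf|exact: cg]. Qed.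

Let sqr_cont (f : 'rV[R]_3 -> R) : continuous f -> continuous (fun x => f x ^+ 2).
Proof. by move=> cf x; exact: (continuousM (cf x) (cf x)). Qed.

Lemma radius_continuous : continuous (@radius R).
Proof.
have h : continuous (fun x : 'rV[R]_3 => x 0 0 ^+ 2 + x 0 1 ^+ 2).
  by apply: add_cont; apply: sqr_cont; exact: coordc.
by move=> x; apply: continuous_comp; [exact: h|exact: sqrt_continuous].
Qed.

Let cap k z0 x : R := radius x ^+ 2 + (x 0 2 - z0 - k) ^+ 2.
Let tube z0 x : R := (`|radius x| + 2^-1) ^+ 2 + (x 0 2 - z0) ^+ 2.

Let cap_continuous k z0 : continuous (cap k z0).
Proof.
apply: add_cont; apply: sqr_cont; first exact: radius_continuous.
by do 2 (apply: add_cont; last exact: cst_continuous); exact: coordc.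
Qed.

Let tube_continuous z0 : continuous (tube z0).
Proof.
apply: add_cont; apply: sqr_cont.
  apply: add_cont; last exact: cst_continuous.
  by move=> x; apply: continuous_comp; [exact: radius_continuous|exact: norm_continuous].
by apply: add_cont; last exact: cst_continuous; exact: coordc.
Qed.

Lemma reuleaux_body_closed k z0 : closed (reuleaux_body k z0).
Proof.
have -> : reuleaux_body k z0 = cap k z0 @^-1` [set t | t <= 1] `&` tube z0 @^-1` [set t | t <= 1].
  by [].
apply: closedI.
  by apply: (continuous_closedP _).1; [exact: cap_continuous|exact: closed_le].
by apply: (continuous_closedP _).1; [exact: tube_continuous|exact: closed_le].
Qed.

Lemma reuleaux_body_compact k z0 : compact (reuleaux_body k z0).
Proof.
pose b := 1 + `|z0|.
have cbox : compact [set x : 'rV[R]_3 | forall i, `[(- b), b]%classic (x 0 i)].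
  by apply: (@rV_compact _ _ (fun=> `[(- b), b]%classic)) => _; exact: segment_compact.
apply: subclosed_compact (@reuleaux_body_closed k z0) cbox _ => x [_].
rewrite ger0_norm ?radius_ge0// => h; have r0 := radius_ge0 x.
have b1 : 1 <= b by rewrite lerDl.
have r1 : radius x ^+ 2 <= 1 by have := sqr_ge0 (x 0 2 - z0); lra.
have unit_itv (a : R) : a ^+ 2 <= 1 -> -1 <= a /\ a <= 1.
  by move=> a1; apply: sqr_le_itv; rewrite ?expr1n.
have aux (a : R) : a ^+ 2 <= 1 -> a \in `[- b, b].
  by move=> /unit_itv[? ?]; rewrite in_itv/=; apply/andP; split; lra.
rewrite sqr_radius in r1; apply: ord3P; rewrite /=.
- by apply: aux; have := sqr_ge0 (x 0 1); lra.
- by apply: aux; have := sqr_ge0 (x 0 0); lra.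
- have /unit_itv[h1 h2] : (x 0 2 - z0) ^+ 2 <= 1 by have := sqr_ge0 (radius x + 2^-1); lra.
  have := ler_norm z0; have := ler_norm (- z0); rewrite normrN in_itv/= /b.
  by move=> h3 h4; apply/andP; split; lra.
Qed.

Lemma reuleaux_body_interior k z0 : k ^+ 2 = 3 / 4 -> interior (reuleaux_body k z0) !=set0.
Proof.
(* The centroid of the triangle: both constraints have left-hand side 1/3 there. *)
move=> k2; exists (row3 (0, 0, z0 + k / 3)).
have r0 : radius (row3 (0, 0, z0 + k / 3)) = 0 by rewrite radius_row3 normr0.
apply: (@filterS _ _ _ (cap k z0 @^-1` [set t | t < 1] `&` tube z0 @^-1` [set t | t < 1])).
  by move=> x [/= h1 h2]; split; exact: ltW.
apply: open_nbhs_nbhs; split.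
  apply: openI; first by apply: (continuousP _).1; [exact: cap_continuous|exact: open_lt].
  by apply: (continuousP _).1; [exact: tube_continuous|exact: open_lt].
split; rewrite /= /cap /tube r0 row3_2 /= ?normr0; lra.
Qed.

Section Transport.
Variables (p n u : 'rV[R]_3) (w k z0 : R).
Hypotheses (nu : orthonormal n u) (w0 : 0 < w) (k2 : k ^+ 2 = 3 / 4).
Let Phi := placement p w n u.
Variable B : set 'rV[R]_3.
Hypothesis BE : Phi @^-1` B = reuleaux_body k z0.

Let PK : cancel (placement_inv p n u w) Phi.
Proof. exact: placement_invK. Qed.

Let BPhi : B = Phi @` reuleaux_body k z0.
Proof.
rewrite -BE; apply/seteqP; split => [x Bx|_ [x Bx <-]//].
by exists (placement_inv p n u w x); rewrite /preimage /= PK.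
Qed.

Lemma reuleaux_placement_convex_body : convex_body B.
Proof.
split.
- rewrite BPhi; apply: continuous_compact; last exact: reuleaux_body_compact.
  by apply: continuous_subspaceT; exact: placement_continuous.
- apply/convex_setP => x y l; rewrite BPhi => -[x' Bx <-] [y' By <-] l0 l1.
  exists (l *: x' + (1 - l) *: y'); last by rewrite placement_convex.
  by move/convex_setP: (@reuleaux_body_convex k z0); apply.
- have [x hx] := reuleaux_body_interior z0 k2; exists (Phi x).
  have -> : B = placement_inv p n u w @^-1` reuleaux_body k z0.
    by rewrite -BE; apply/seteqP; split => y; rewrite /preimage /= PK.
  apply: (@placement_inv_continuous _ p n u w (Phi x)).
  by rewrite placementK.
Qed.

Lemma reuleaux_placement_rotation f : rotation_about p u f -> f @` B = B.
Proof.
move=> rf.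
have rB x y : Phi y = f (Phi x) -> reuleaux_body k z0 x <-> reuleaux_body k z0 y.
  move=> yx; have [ryx zyx] := rotation_radius nu w0 rf yx.
  by split; apply: reuleaux_body_radial.
apply/seteqP; split => [_ [x Bx <-]|y By].
  move: Bx; rewrite {1}BPhi => -[x' Bx <-].
  rewrite -(PK (f (Phi x'))) BPhi; exists (placement_inv p n u w (f (Phi x'))) => //.
  by apply: (rB x' _ _).1 Bx; rewrite PK.
have [A [AA _ _ fE]] := rf.
have fx : f (p + (y - p) *m A^T) = y.
  by rewrite fE (addrAC p) subrr add0r -mulmxA (mulmx1C AA) mulmx1 subrKC.
exists (p + (y - p) *m A^T) => //.
move: fx; rewrite -(PK (p + _)); set x := placement_inv _ _ _ _ _ => fx.
rewrite BPhi; exists x => //; apply: (rB x (placement_inv p n u w y) _).2; first by rewrite PK.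
by move: By; rewrite {1}BPhi => -[y' By <-]; rewrite placementK.
Qed.

Lemma reuleaux_placement_width : has_width B w.
Proof.
apply: diametral_has_width; first exact: ltW.
by apply/(diametral_placement p nu w0); rewrite BE; exact: reuleaux_body_diametral.
Qed.

End Transport.
End ReuleauxBody.

(** * Symmetry axes of a Reuleaux triangle *)

Section Triangles.
Context {R : realType}.
Implicit Types (a b c x y p n u : 'rV[R]_3) (r s t z k w l : R).

(** For a vertex on the axis, squaring [E] gives [E2], whence [(ra + rb)^2 = 3 (ra^2 + rb^2) - 3/2].
    The bounds [|ra|, |rb| <= 1/2] make the right side nonpositive, so the other two vertices are
    mirror images. *)
Let triangle_apex (ra za rb zb zc : R) :
  ra ^+ 2 + (za - zc) ^+ 2 = 1 -> rb ^+ 2 + (zb - zc) ^+ 2 = 1 ->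
  (ra - rb) ^+ 2 + (za - zb) ^+ 2 = 1 ->
  (2 * ra) ^+ 2 <= 1 -> (2 * rb) ^+ 2 <= 1 ->
  [/\ ra ^+ 2 = 1 / 4, rb = - ra, zb = za & (zc - za) ^+ 2 = 3 / 4].
Proof.
move=> ha hb hab ra2 rb2.
have E : (za - zc) * (zb - zc) = 2^-1 - ra * rb by lra.
have E2 : ra ^+ 2 + rb ^+ 2 - ra * rb = 3 / 4.
  have : ((za - zc) * (zb - zc)) ^+ 2 = (1 - ra ^+ 2) * (1 - rb ^+ 2).
    have -> : 1 - ra ^+ 2 = (za - zc) ^+ 2 by lra.
    have -> : 1 - rb ^+ 2 = (zb - zc) ^+ 2 by lra.
    by ring.
  by rewrite E; lra.
have S0 : (ra + rb) ^+ 2 = 0.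
  by apply/eqP; rewrite eq_le sqr_ge0 andbT; have := sqr_ge0 (ra + rb); lra.
have rab : rb = - ra by move/eqP: S0; rewrite sqrf_eq0 => /eqP; lra.
have ra4 : ra ^+ 2 = 1 / 4 by move: E2; rewrite rab; lra.
have Z0 : (za - zb) ^+ 2 = 0 by move: hab; rewrite rab; lra.
have zab : zb = za by move/eqP: Z0; rewrite sqrf_eq0 => /eqP; lra.
by split=> //; lra.
Qed.

Definition near_point r z (q : R * R) := (r - q.1) ^+ 2 + (z - q.2) ^+ 2 <= 1.

Let apex_profile (qa qb qc : R * R) : qc.1 = 0 ->
  (qa.1 - qb.1) ^+ 2 + (qa.2 - qb.2) ^+ 2 = 1 ->
  (qb.1 - qc.1) ^+ 2 + (qb.2 - qc.2) ^+ 2 = 1 ->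
  (qc.1 - qa.1) ^+ 2 + (qc.2 - qa.2) ^+ 2 = 1 ->
  (2 * qa.1) ^+ 2 <= 1 -> (2 * qb.1) ^+ 2 <= 1 ->
  exists k z0, k ^+ 2 = 3 / 4 /\ forall r z,
    [/\ near_point r z qa, near_point r z qb & near_point r z qc] <->
    reuleaux_profile k r (z - z0).
Proof.
case: qa qb qc => [ra za] [rb zb] [rc zc] /= -> hab hb hc ra2 rb2.
have [|||||ra4 rab zab k2] := @triangle_apex ra za rb zb zc => //; [lra|lra|].
exists (zc - za), za; split => // r z; rewrite /near_point /reuleaux_profile /= rab zab subr0.
have -> : z - za - (zc - za) = z - zc by ring.
have ra2E : ra = 2^-1 \/ ra = - 2^-1.
  have /eqP : ra ^+ 2 = 2^-1 ^+ 2 by rewrite ra4; field.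
  by rewrite eqf_sqr => /orP[]/eqP; [left|right].
by have [rp|rn] := ger0P r; case: ra2E => raE; split=> [[h1 h2 h3]|[h1 h2]];
  rewrite ?raE in h1 h2 *; split; lra.
Qed.

(* The mirror image of each vertex is within 1 of all three vertices. For two
   vertices at abscissas r and r' this gives r * r' <= 0, so some vertex lies on
   the axis, and r = r' gives |r| <= 1/2, which fixes the other two. *)
Lemma reuleaux_triangle_profile (qa qb qc : R * R) (T : R -> R -> Prop) :
  (forall r z, T r z <-> [/\ near_point r z qa, near_point r z qb & near_point r z qc]) ->
  (qa.1 - qb.1) ^+ 2 + (qa.2 - qb.2) ^+ 2 = 1 ->
  (qb.1 - qc.1) ^+ 2 + (qb.2 - qc.2) ^+ 2 = 1 ->
  (qc.1 - qa.1) ^+ 2 + (qc.2 - qa.2) ^+ 2 = 1 ->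
  (forall r z, T r z -> T (- r) z) ->
  exists k z0, k ^+ 2 = 3 / 4 /\ forall r z, T r z <-> reuleaux_profile k r (z - z0).
Proof.
move=> TE hab hbc hca symT.
have [a1 a2 a3] : [/\ near_point (- qa.1) qa.2 qa, near_point (- qa.1) qa.2 qb &
    near_point (- qa.1) qa.2 qc].
  by apply/TE/symT/TE; rewrite /near_point; split; lra.
have [b1 b2 b3] : [/\ near_point (- qb.1) qb.2 qa, near_point (- qb.1) qb.2 qb &
    near_point (- qb.1) qb.2 qc].
  by apply/TE/symT/TE; rewrite /near_point; split; lra.
have [c1 c2 c3] : [/\ near_point (- qc.1) qc.2 qa, near_point (- qc.1) qc.2 qb &
    near_point (- qc.1) qc.2 qc].
  by apply/TE/symT/TE; rewrite /near_point; split; lra.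
rewrite /near_point in a1 a2 a3 b1 b2 b3 c1 c2 c3.
have ha : (2 * qa.1) ^+ 2 <= 1 by lra.
have hb : (2 * qb.1) ^+ 2 <= 1 by lra.
have hc : (2 * qc.1) ^+ 2 <= 1 by lra.
have ab : qa.1 * qb.1 <= 0 by lra.
have bc : qb.1 * qc.1 <= 0 by lra.
have ca : qc.1 * qa.1 <= 0 by lra.
(* This square is the product of three nonpositive numbers, the pairwise products of the
   abscissas. *)
have /eqP : (qa.1 * qb.1 * qc.1) ^+ 2 = 0.
  apply/eqP; rewrite eq_le sqr_ge0 andbT.
  rewrite (_ : _ ^+ 2 = (qa.1 * qb.1) * (qb.1 * qc.1) * (qc.1 * qa.1)); last by ring.
  by rewrite mulr_ge0_le0// mulr_le0.
rewrite sqrf_eq0 !mulf_eq0 => /orP[/orP[]|] /eqP h0.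
- have [k [z0 [k2 h]]] := apex_profile h0 hbc hca hab hb hc.
  by exists k, z0; split => // r z; rewrite TE -h; split=> -[].
- have [k [z0 [k2 h]]] := apex_profile h0 hca hab hbc hc ha.
  by exists k, z0; split => // r z; rewrite TE -h; split=> -[].
- have [k [z0 [k2 h]]] := apex_profile h0 hab hbc hca ha hb.
  by exists k, z0; split => // r z; rewrite TE -h; split=> -[].
Qed.

Lemma placement_row3 p n u w r z :
  placement p w n u (row3 (r, 0, z)) = p + w *: (r *: n + z *: u).
Proof.
apply/rowP => i; rewrite /placement -scalemxAr !mxE big_ord3 !row3E !mxE /=; ring.
Qed.

Lemma line_reflection_placement p n u w r z : orthonormal n u ->
  line_reflection p u (placement p w n u (row3 (r, 0, z))) =
  placement p w n u (row3 (- r, 0, z)).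
Proof.
move=> nu; rewrite /line_reflection placement_axis// row3_2 /= !placement_row3.
by apply/rowP => i; rewrite !mxE; ring.
Qed.

(* With e1 = b - a, e2 = c - a and u = s e1 + t e2, the vector
   m = (e2 . u) e1 - (e1 . u) e2 is orthogonal to u, and
   e1 = (e1 . u) u + t m, e2 = (e2 . u) u - s m. *)
Lemma plane_orthonormal a b c p u : equilateral a b c -> dot u u = 1 ->
  line p u `<=` plane_through a b c ->
  exists2 n, orthonormal n u & forall x, plane_through a b c x <->
    exists r z, x = p + (r *: n + z *: u).
Proof.
move=> [ab hbc hca] u1 Lp.
have [e1 Ee1] : exists e1, e1 = b - a by exists (b - a).
have [e2 Ee2] : exists e2, e2 = c - a by exists (c - a).
pose W := dot e1 e1.
have W0 : 0 < W by rewrite lt_neqAle dot_ge0 andbT eq_sym dot_eq0 Ee1 subr_eq0 eq_sym.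
have WE : edist a b ^+ 2 = W by rewrite edist_sqr /W Ee1 -(opprB b) dotNl dotNr opprK.
have e22 : dot e2 e2 = W by rewrite Ee2 -edist_sqr hca.
have e12 : 2 * dot e1 e2 = W.
  have : dot (e1 - e2) (e1 - e2) = W.
    by rewrite (_ : e1 - e2 = b - c) -?edist_sqr ?hbc// Ee1 Ee2 opprB addrA subrK.
  rewrite !dotE [dot e2 e1]dotC e22 -/W; lra.
have [s0 [t0 pE]] : plane_through a b c p by apply: Lp; exists 0; rewrite scale0r addr0.
have [s1 [t1 puE]] : plane_through a b c (p + u) by apply: Lp; exists 1; rewrite scale1r.
pose s := s1 - s0; pose t := t1 - t0.
have uE : u = s *: e1 + t *: e2.
  rewrite -[u](addKr p) puE pE /s /t -Ee1 -Ee2.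
  by apply/rowP => i; rewrite !mxE; ring.
set al := dot e1 u; set be := dot e2 u.
have D : s * al + t * be = 1 by rewrite -u1 {1}uE dotDl !dotZl.
have [m mE] : exists m, m = be *: e1 - al *: e2 by exists (be *: e1 - al *: e2).
have e1E : e1 = al *: u + t *: m.
  rewrite mE uE; apply/rowP => i; rewrite !mxE -[LHS]mul1r -D; ring.
have e2E : e2 = be *: u - s *: m.
  rewrite mE uE; apply/rowP => i; rewrite !mxE -[LHS]mul1r -D; ring.
have mu : dot m u = 0 by rewrite mE dotDl dotNl !dotZl -/al -/be; ring.
(* Otherwise both edges would be parallel to [u]: [W = al^2 = be^2] and [2 al be = W] would give
   [4 W^2 = W^2]. *)
have m0 : m != 0.
  apply/eqP => m0.
  have := e22; rewrite e2E m0 scaler0 subr0 !dotE u1 => h1.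
  have h3 : W = al * al by rewrite /W e1E m0 scaler0 addr0 !dotE u1; ring.
  have : 0 < W * W by rewrite mulr_gt0.
  have h4 : W = be * be by rewrite -h1; ring.
  have h5 : 2 * (al * be) = W.
    by move: e12; rewrite e2E m0 scaler0 subr0 dotZr -/al => <-; ring.
  have : (2 * (al * be)) ^+ 2 = 4 * (W * W) by rewrite {1}h3 h4; ring.
  by rewrite h5; lra.
set N := enorm m.
have N0 : N != 0 by rewrite sqrtr_eq0 -ltNge lt_neqAle dot_ge0 andbT eq_sym dot_eq0.
have NN : N * N = dot m m by rewrite -expr2 sqr_enorm.
exists (N^-1 *: m).
  split=> //; last by rewrite dotZl mu mulr0.
  by rewrite dotZl dotZr -NN; field.
move=> x; split=> [[s' [t' ->]]|[r [z ->]]].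
- exists (N * ((s' - s0) * t - (t' - t0) * s)), ((s' - s0) * al + (t' - t0) * be).
  rewrite pE -Ee1 -Ee2 e1E e2E; apply/rowP => i; rewrite !mxE; field.
  exact: N0.
- exists (s0 + r / N * be + z * s), (t0 - r / N * al + z * t).
  rewrite pE -Ee1 -Ee2 {1}uE mE; apply/rowP => i; rewrite !mxE; field.
  exact: N0.
Qed.

End Triangles.

(** * The minimum of the ratio *)

Section Comparison.
Context {R : realType}.
Implicit Types (a b c x y p n u : 'rV[R]_3) (w : R) (B : set 'rV[R]_3).

Lemma width_unique B w u : dot u u = 1 -> has_width B w -> width B = w.
Proof.
move=> u1 hw; apply: xget_unique => // w' hw'.
have u1' : enorm u = 1 by exact/enorm_eq1.
by rewrite -(hw u u1') -(hw' u u1').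
Qed.

(** The cube of the width cancels the determinant of the similarity, so ratios are compared as
    volumes of copies of width 1. *)
Lemma volume_width_ratio_placement p n u w B : orthonormal n u -> 0 < w ->
  closed B -> has_width B w ->
  volume_width_ratio B = volume (placement p w n u @^-1` B).
Proof.
move=> nu w0 cB hw; have [_ u1 _] := nu.
rewrite /volume_width_ratio (width_unique u1 hw) (placement_volume p nu w0 cB).
by rewrite -muleA -EFinM mulfV ?mule1// expf_neq0// gt_eqF.
Qed.

(** Coordinates are taken along [n] and [u] in the plane of the triangle, with the side length as
    unit. The symmetry becomes [r] to [-r], and [reuleaux_triangle_profile] gives the position of
    the triangle. *)
Lemma reuleaux_placement a b c p u : equilateral a b c ->
  symmetry_axis_in (plane_through a b c) (reuleaux a b c) p u ->
  exists n w k z0, [/\ orthonormal n u, 0 < w, k ^+ 2 = 3 / 4 &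
    placement p w n u @^-1` revolve p u (reuleaux a b c) = reuleaux_body k z0].
Proof.
move=> eq_abc [/enorm_eq1 u1 Lp sT]; have [ab hbc hca] := eq_abc.
have [n nu plE] := plane_orthonormal eq_abc u1 Lp.
set w := edist a b.
have w0 : 0 < w.
  rewrite lt_neqAle edist_ge0 andbT eq_sym; apply: contra ab => /eqP w0.
  by rewrite -subr_eq0 -dot_eq0 -edist_sqr -/w w0 expr0n.
pose Phi := placement p w n u.
pose pt (q : R * R) : 'rV[R]_3 := row3 (q.1, 0, q.2).
have plane_pt x : plane_through a b c x <-> exists q, x = Phi (pt q).
  split=> [/plE[r [z ->]]|[q ->]].
    exists (r / w, z / w); rewrite /Phi /pt placement_row3 /=.
    by apply/rowP => i; rewrite !mxE; field; rewrite gt_eqF.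
  apply/plE; exists (w * q.1), (w * q.2).
  by rewrite /Phi /pt placement_row3; apply/rowP => i; rewrite !mxE; ring.
have [qa aE] : exists q, a = Phi (pt q).
  by apply/plane_pt; exists 0, 0; rewrite !scale0r !addr0.
have [qb bE] : exists q, b = Phi (pt q).
  by apply/plane_pt; exists 1, 0; rewrite scale0r scale1r addr0 subrKC.
have [qc cE] : exists q, c = Phi (pt q).
  by apply/plane_pt; exists 0, 1; rewrite scale0r scale1r addr0 subrKC.
have dpt q q' : dot (pt q - pt q') (pt q - pt q') =
    (q.1 - q'.1) ^+ 2 + (q.2 - q'.2) ^+ 2.
  by rewrite /pt row3B dot3E !row3E /= subr0 mulr0 addr0 -!expr2.
pose T r z := reuleaux a b c (Phi (row3 (r, 0, z))).
have TE r z : T r z <-> [/\ near_point r z qa, near_point r z qb & near_point r z qc].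
  have nearE q : eball (Phi (pt q)) w (Phi (pt (r, z))) <-> near_point r z q.
    by rewrite /eball /= placement_edist_le// dpt.
  rewrite /T /reuleaux -/w.
  split=> [[_ [[]]]|[/nearE h1 /nearE h2 /nearE h3]].
    by rewrite {1}aE {1}bE {1}cE => /nearE h1 /nearE h2 /nearE h3.
  split; first by apply/plane_pt; exists (r, z).
  by split; [split; [rewrite aE|rewrite bE]|rewrite cE].
have dist q q' : edist (Phi (pt q)) (Phi (pt q')) = w ->
    (q.1 - q'.1) ^+ 2 + (q.2 - q'.2) ^+ 2 = 1.
  by move=> /(placement_edist_eq nu w0); rewrite dpt.
have symT r z : T r z -> T (- r) z.
  move=> Trz; rewrite /T /Phi -line_reflection_placement//.
  by rewrite -[reuleaux a b c]sT; exists (Phi (row3 (r, 0, z))).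
have [k [z0 [k2 kE]]] : exists k z0, k ^+ 2 = 3 / 4 /\
    forall r z, T r z <-> reuleaux_profile k r (z - z0).
  apply: (reuleaux_triangle_profile TE) => //; apply: dist.
  - by rewrite -aE -bE.
  - by rewrite -bE -cE hbc.
  - by rewrite -cE -aE hca.
exists n, w, k, z0; split => //; apply/seteqP; split => x.
- move=> [f rf [y Ty fyx]].
  have [[r z] yE] : exists q, y = Phi (pt q) by apply/plane_pt; case: Ty.
  have [] := @rotation_radius _ p n u w nu w0 f (pt (r, z)) x rf.
    by rewrite -/(Phi x) -[LHS]fyx yE.
  rewrite /pt radius_row3 row3_2 /= /reuleaux_body /= => -> ->.
  have /kE : T r z by rewrite /T -[row3 _]/(pt (r, z)) -yE.
  by rewrite /reuleaux_profile normr_id real_normK ?num_real.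
- move=> /kE Tx.
  have [||f rf fx] := @radius_rotation _ p n u w nu (row3 (radius x, 0, x 0 2)) x.
  + by rewrite radius_row3 ger0_norm ?radius_ge0.
  + by rewrite row3_2.
  + by exists f => //; exists (Phi (row3 (radius x, 0, x 0 2))).
Qed.

Lemma le_volume_width_ratio_reuleaux p n u w (k z0 : R) BReul B :
  orthonormal n u -> 0 < w -> k ^+ 2 = 3 / 4 ->
  placement p w n u @^-1` BReul = reuleaux_body k z0 ->
  constant_width_body_of_revolution B ->
  (volume_width_ratio BReul <= volume_width_ratio B)%E.
Proof.
move=> nu w0 k2 BE [[bB [p' [u' [/enorm_eq1 u1 rB]]]] [w' hw']].
have cl B' : convex_body B' -> closed B' by move=> [cB _ _]; exact: compact_closed.
have w0' : 0 < w'.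
  by rewrite -(hw' u') ?width_in_direction_gt0//; exact/enorm_eq1.
have [n' nu'] := exists_orthonormal u1.
have bR := reuleaux_placement_convex_body nu w0 k2 BE.
have hw := reuleaux_placement_width nu w0 k2 BE.
rewrite (volume_width_ratio_placement p nu w0 (cl _ bR) hw).
rewrite (volume_width_ratio_placement p' nu' w0' (cl _ bB) hw') BE.
have [cB xB [x /interior_subset Bx]] := bB.
have cH : closed (placement p' w' n' u' @^-1` B).
  by apply: (continuous_closedP _).1 (cl _ bB); exact: placement_continuous.
apply: (le_volume_reuleaux (z0 := z0) k2 (@reuleaux_body_closed _ k z0) cH) => //.
- apply/convex_setP => y z l Hy Hz l0 l1; rewrite /preimage /= -placement_convex.
  exact: ((convex_setP B).1 xB).
- move=> y z rzy h Hy; have [f rf fz] := @radius_rotation _ p' n' u' w' nu' y z rzy h.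
  by rewrite /preimage /= fz -(rB f rf); exists (placement p' w' n' u' y).
- apply/diametral_placement => //; apply: has_width_diametral => //; last exact: ltW.
  by exists x.
Qed.

End Comparison.

Theorem mainTheorem1 (R : realType) (BReul : set 'rV[R]_3)
    (hReul : is_B_Reul BReul) :
  constant_width_body_of_revolution BReul /\
  (forall B : set 'rV[R]_3, constant_width_body_of_revolution B ->
     (volume_width_ratio BReul <= volume_width_ratio B)%E).
Proof.
have [a [b [c [p [u [eq_abc sym ->]]]]]] := hReul.
have [n [w [k [z0 [nu w0 k2 BE]]]]] := reuleaux_placement eq_abc sym.
split; last by move=> B; exact: le_volume_width_ratio_reuleaux BE.
split; last by exists w; exact: reuleaux_placement_width BE.
split; first exact: reuleaux_placement_convex_body BE.
exists p, u; split; first by apply/enorm_eq1; case: nu.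
exact: reuleaux_placement_rotation BE.
Qed.
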